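(* Let $p$ be a prime, let $n\geq 1$, and let $A$ be an $\omega$-categorical associative algebra over $\mathbb{F}_p$. If the associated Lie algebra $L(A)$ is $n$-Engel, then $L(A)$ is nilpotent as a Lie algebra.
   Context: A structure $M$ is $\omega$-categorical if its first-order theory has a unique countable model up to isomorphism (finite structures are allowed); by the Ryll-Nardzewski theorem, for countable $M$ this is equivalent to: for every $n\in\mathbb{N}$ the componentwise action of $\mathrm{Aut}(M)$ on $M^n$ has only finitely many orbits, and the latter may be taken as the definition. Algebras are viewed as structures with $+$ and multiplication. Associative algebras are not assumed unital. For an associative algebra $A$, the associated Lie algebra $L(A)$ has the same underlying vector space and bracket $[x,y]=xy-yx$. A Lie algebra is $n$-Engel if $[x,y,\ldots,y]=0$ ($y$ repeated $n$ times, left-normed bracket: $[x,y,z]=[[x,y],z]$) for all $x,y$. *)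

(* Defs.v *)
From HB Require Import structures.
From mathcomp Require Import all_boot all_order all_algebra.
From mathcomp Require Import boolp classical_sets functions cardinality.

Set Implicit Arguments.
Unset Strict Implicit.
Unset Printing Implicit Defensive.

Import GRing.Theory.

Local Open Scope classical_set_scope.
Local Open Scope ring_scope.

(* MathComp's [algType] is unital, hence a separate structure for associative
   algebras that need not have a unit. *)
HB.mixin Record Lmodule_isAssocAlg (K : fieldType) A of GRing.Lmodule K A := {
  amul : A -> A -> A;
  amulA : associative amul;
  amulDl : left_distributive amul +%R;
  amulDr : right_distributive amul +%R;
  amulZl : forall (k : K) (x y : A), amul (k *: x) y = k *: amul x y;
  amulZr : forall (k : K) (x y : A), amul x (k *: y) = k *: amul x y
}.

#[short(type="assocAlgType")]
HB.structure Definition AssocAlg (K : fieldType) :=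
  {A of GRing.Lmodule K A & Lmodule_isAssocAlg K A}.

HB.mixin Record Lmodule_isLieAlg (K : fieldType) L of GRing.Lmodule K L := {
  lie : L -> L -> L;
  lieDl : left_distributive lie +%R;
  lieDr : right_distributive lie +%R;
  lieZl : forall (k : K) (x y : L), lie (k *: x) y = k *: lie x y;
  lieZr : forall (k : K) (x y : L), lie x (k *: y) = k *: lie x y;
  liexx : forall x : L, lie x x = 0;
  lie_jacobi : forall x y z : L,
    lie x (lie y z) + lie y (lie z x) + lie z (lie x y) = 0
}.

#[short(type="lieAlgType")]
HB.structure Definition LieAlg (K : fieldType) :=
  {L of GRing.Lmodule K L & Lmodule_isLieAlg K L}.

(* [lie_of A] is the associated Lie algebra L(A): an alias of the carrier. *)
Definition lie_of (K : fieldType) (A : assocAlgType K) : Type := A.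

Section LieOf.
Variables (K : fieldType) (A : assocAlgType K).
Implicit Types x y z : A.

HB.instance Definition _ := GRing.Lmodule.on (lie_of A).

Definition commutator x y : A := amul x y - amul y x.

Lemma amulNl x y : amul (- x) y = - amul x y.
Proof. by rewrite -scaleN1r amulZl scaleN1r. Qed.

Lemma amulNr x y : amul x (- y) = - amul x y.
Proof. by rewrite -scaleN1r amulZr scaleN1r. Qed.

Fact commutatorDl : left_distributive commutator +%R.
Proof. by move=> x y z; rewrite /commutator amulDl amulDr opprD addrACA. Qed.

Fact commutatorDr : right_distributive commutator +%R.
Proof. by move=> x y z; rewrite /commutator amulDl amulDr opprD addrACA. Qed.

Fact commutatorZl (k : K) x y : commutator (k *: x) y = k *: commutator x y.
Proof. by rewrite /commutator amulZl amulZr scalerBr. Qed.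

Fact commutatorZr (k : K) x y : commutator x (k *: y) = k *: commutator x y.
Proof. by rewrite /commutator amulZl amulZr scalerBr. Qed.

Fact commutatorxx x : commutator x x = 0.
Proof. exact: subrr. Qed.

Fact commutator_jacobi x y z :
  commutator x (commutator y z) + commutator y (commutator z x)
    + commutator z (commutator x y) = 0.
Proof.
rewrite /commutator !amulDl !amulDr !amulNl !amulNr !amulA !opprB.
set a := amul (amul x y) z; set b := amul (amul x z) y.
set c := amul (amul y z) x; set d := amul (amul y x) z.
set e := amul (amul z x) y; set f := amul (amul z y) x.
by rewrite (AC (2*2*2) (1*4*5*2*3*6)) /= !addrA !subrK subrr.
Qed.

HB.instance Definition _ := Lmodule_isLieAlg.Build K (lie_of A)
  commutatorDl commutatorDr commutatorZl commutatorZr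
  commutatorxx commutator_jacobi.

End LieOf.

Section LieTheory.
Variables (K : fieldType) (L : lieAlgType K).

Definition n_engel (n : nat) : Prop :=
  forall x y : L, iter n (fun z => lie z y) x = 0.

Definition lspan (S : set L) : set L :=
  [set v | exists (m : nat) (c : 'I_m -> K) (w : 'I_m -> L),
     (forall i, S (w i)) /\ v = \sum_(i < m) c i *: w i].

(* Indexed from 0: [lower_central 0] is the whole algebra. *)
Fixpoint lower_central (i : nat) : set L :=
  if i is j.+1 then lspan [set lie x y | x in lower_central j & y in setT]
  else setT.

Definition lie_nilpotent : Prop := exists c : nat, lower_central c = [set 0].

End LieTheory.

Section OmegaCategorical.
Variables (K : fieldType) (A : assocAlgType K).

(* The language has addition and multiplication only; over a prime field such
   maps are automatically linear. *)
Definition is_aut (f : A -> A) : Prop :=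
  [/\ bijective f, {morph f : x y / x + y} &
      {morph f : x y / amul x y}].

Definition aut_orbit (n : nat) (t : n.-tuple A) : set (n.-tuple A) :=
  [set map_tuple f t | f in is_aut].

Definition omega_categorical : Prop :=
  forall n : nat, finite_set (range (@aut_orbit n)).

End OmegaCategorical.

Arguments n_engel {K} L n.
Arguments lie_nilpotent {K} L.
Arguments omega_categorical {K} A.

(* Main.v *)
Require Import Defs.
From HB Require Import structures.
From mathcomp Require Import all_boot all_order all_algebra all_fingroup.
From mathcomp Require Import generic_quotient ring_quotient.
From mathcomp Require Import boolp classical_sets functions cardinality.
From mathcomp Require Import ring.

(** If q = p^k >= n then ad(y)^q = ad(y^q), so the Engel identity makes every y^q
central. By omega-categoricity there is a power Q of p such that a^Q is central and
a - a^Q is nilpotent for every a; the nilpotent elements form an ideal N of bounded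
index, and L(A) and N have the same commutators. So it suffices that a nil ideal of
bounded index whose automorphism group is oligomorphic is nilpotent (Cherlin).

If it is not, some subquotient R satisfies R R = R <> 0 and has no proper nonzero
invariant ideal. In R the ideal generated by an element is nilpotent, with a uniform
bound, so there is a largest m for which the symmetrized words
    f(x_1, .., x_m) = sum_s y_1 x_{s 1} .. y_m x_{s m}
do not all vanish. The vanishing for m + 1 gives exchange identities like those of
determinants (Razmyslov, Zubrilin), hence for all a, b the "trace"
    f |-> sum_i f(x_1, .., a x_i b, .., x_m)
is a multiplier of R commuting with all multiplications. Some trace is nonzero, and
it is nilpotent, so the centroid of R contains long nonzero products of square-zero
elements. These encode, for X, Y, b in R, relations b = X u_1, Y u_1 = X u_2, ..,
Y u_n = 0 of arbitrarily large minimal length n, which contradicts oligomorphy. *)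

Set Implicit Arguments.
Unset Strict Implicit.
Unset Printing Implicit Defensive.

Import GRing.Theory.

Local Open Scope classical_set_scope.
Local Open Scope ring_scope.

(** * A chain of square-zero elements *)

(* For triples [(a_i, b_i, g_i)] of square-zero elements: [x = sum a_i b_i],
   [y = sum a_i g_i], [sum_r e_r 't^r = prod (g_i + b_i 't)] and
   [v_j = prod_(i < j) a_i g_i * prod_(i > j) a_i b_i]. *)
Lemma square_zero_chain (K : comNzRingType) (k : nat) :
  (forall t : K, t != 0 -> exists a, a * a = 0 /\ t * a != 0) ->
  exists (x y : K) (e v : nat -> K),
    [/\ y * e 0%N = 0, forall r, y * e r.+1 = x * e r,
        forall j, (j < k)%N -> x * v j.+1 = y * v j & x * e 0%N * v 0%N != 0].
Proof.
move=> hK.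
suff [x [y [e [v [g [h1 h2 h3 [h4 _ _ _]]]]]]] : exists (x y : K) (e v : nat -> K) (g : K),
    [/\ y * e 0%N = 0, forall r, y * e r.+1 = x * e r,
        forall j, (j < k)%N -> x * v j.+1 = y * v j &
        [/\ x * e 0%N * v 0%N != 0, x * g = 0, y * g = 0 & y * v k = g]].
  by exists x, y, e, v.
elim: k => [|k [x [y [e [v [G [h1 h2 h3 [h4 h5 h6 h7]]]]]]]].
  have [a [a0]] := hK 1 (oner_neq0 _); rewrite mul1r => na.
  have [b [b0 nb]] := hK _ na; have [g [g0 ng]] := hK _ nb.
  exists (a * b), (a * g), (fun r => if r is r'.+1 then (if r' is 0%N then b else 0) else g).
  exists (fun=> 1), (a * g); split => //.
  - by rewrite -mulrA g0 mulr0.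
  - case=> [|[|r]]; rewrite ?mulr0 //; first by rewrite mulrAC.
    by rewrite -mulrA b0 mulr0.
  split; rewrite ?mulr1 //.
  - by rewrite mulrACA a0 mul0r.
  - by rewrite mulrACA a0 mul0r.
have [a [a0 na]] := hK _ h4; have [b [b0 nb]] := hK _ na.
have [g [g0 ng]] := hK _ nb.
exists (x + a * b), (y + a * g).
exists (fun r => if r is r'.+1 then g * e r'.+1 + b * e r' else g * e 0%N).
exists (fun j => if (j <= k)%N then a * b * v j else G), (a * g * G); split.
- rewrite [LHS](_ : _ = g * (y * e 0%N) + a * e 0%N * (g * g)); last by ring.
  by rewrite h1 g0 !mulr0 addr0.
- case=> [|r].
    rewrite [LHS](_ : _ = g * (y * e 1%N) + b * (y * e 0%N)
      + a * e 1%N * (g * g) + a * b * g * e 0%N); last by ring.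
    by rewrite h1 h2 g0; ring.
  rewrite [LHS](_ : _ = g * (y * e r.+2) + b * (y * e r.+1)
    + a * e r.+2 * (g * g) + a * b * g * e r.+1); last by ring.
  rewrite !h2 g0.
  rewrite [RHS](_ : _ = g * (x * e r.+1) + b * (x * e r) + a * b * g * e r.+1
    + (b * b) * (a * e r)); last by ring.
  by rewrite b0; ring.
- move=> j; rewrite ltnS => lejk; rewrite lejk; case: ltnP => jk.
    rewrite [LHS](_ : _ = a * b * (x * v j.+1) + a * a * (b * b * v j.+1)); last by ring.
    rewrite [RHS](_ : _ = a * b * (y * v j) + a * a * (b * g * v j)); last by ring.
    by rewrite h3 // a0; ring.
  have -> : j = k by apply/eqP; rewrite eqn_leq lejk jk.
  rewrite [RHS](_ : _ = a * b * (y * v k) + a * a * (b * g * v k)); last by ring.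
  by rewrite h7 a0 mulrDl h5; ring.
rewrite /= ltnn; split.
- rewrite [X in X != 0](_ : _ = x * e 0%N * v 0%N * a * b * g
   + a * a * (b * b * g * e 0%N * v 0%N)); last by ring.
  by rewrite a0 mul0r addr0.
- rewrite [LHS](_ : _ = a * g * (x * G) + a * a * (b * g * G)); last by ring.
  by rewrite h5 a0 mulr0 mul0r addr0.
- rewrite [LHS](_ : _ = a * g * (y * G) + a * a * (g * g * G)); last by ring.
  by rewrite h6 a0 mulr0 mul0r addr0.
- by rewrite mulrDl h6 add0r.
Qed.

(** * Additive spans and symmetrized words *)

Section Spans.
Variable V : nzRingType.
Implicit Types (H K S : set V).

Definition subgrp H := H 0 /\ forall x y, H x -> H y -> H (x - y).

Definition addspan S : set V :=
  [set z | forall H, subgrp H -> S `<=` H -> H z].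

Definition ideal2 K :=
  [/\ subgrp K, forall u x, K x -> K (u * x) & forall u x, K x -> K (x * u)].

Lemma subgrpN H x : subgrp H -> H x -> H (- x).
Proof. by move=> [H0 HB] Hx; rewrite -sub0r; apply: HB. Qed.

Lemma subgrpD H x y : subgrp H -> H x -> H y -> H (x + y).
Proof. by move=> sH Hx Hy; rewrite -[y]opprK; apply: sH.2 => //; apply: subgrpN. Qed.

Lemma subgrp_sum H (I : Type) (r : seq I) (P : pred I) (F : I -> V) :
  subgrp H -> (forall i, P i -> H (F i)) -> H (\sum_(i <- r | P i) F i).
Proof.
by move=> sH HF; apply: big_ind => //; [exact: sH.1 | move=> x y; exact: subgrpD].
Qed.

Lemma addspan_sub S : S `<=` addspan S.
Proof. by move=> x Sx H _; apply. Qed.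

Lemma addspan_subgrp S : subgrp (addspan S).
Proof.
split=> [H [] //|x y Sx Sy H sH SH].
exact: sH.2 (Sx _ sH SH) (Sy _ sH SH).
Qed.

Lemma addspan_le S H : subgrp H -> S `<=` H -> addspan S `<=` H.
Proof. by move=> sH SH x; apply. Qed.

Lemma addspan_map S S' (g : V -> V) : {morph g : x y / x - y} ->
  (forall x, S x -> addspan S' (g x)) -> forall x, addspan S x -> addspan S' (g x).
Proof.
move=> gB gS x Sx; apply: (Sx [set z | addspan S' (g z)]) => //.
have g0 : g 0 = 0 by rewrite -[in LHS](subrr 0) gB subrr.
split=> /= [|a b Ha Hb]; first by rewrite g0; exact: (addspan_subgrp _).1.
by rewrite gB; apply: (addspan_subgrp _).2.
Qed.

Lemma addspan_ideal S : (forall u x, S x -> S (u * x)) ->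
  (forall u x, S x -> S (x * u)) -> ideal2 (addspan S).
Proof.
move=> Sl Sr; split; first exact: addspan_subgrp.
  move=> u; apply: addspan_map => [x y|x Sx]; first by rewrite mulrBr.
  by apply: addspan_sub; apply: Sl.
move=> u x; apply: (@addspan_map S S ( *%R^~ u)) => [{}x y|{}x Sx] /=; first by rewrite mulrBl.
by apply: addspan_sub; apply: Sr.
Qed.

End Spans.

Section SymmetricForms.
Variable V : nzRingType.

Definition symf m (y : nat -> V) (x : 'I_m -> V) : V :=
  \sum_(s : 'S_m) \prod_(k < m) (y k * x (s k)).

Definition upd m (x : 'I_m -> V) i w : 'I_m -> V :=
  fun j => if j == i then w else x j.

Lemma upd_id m (x : 'I_m -> V) i w : upd x i w i = w.
Proof. by rewrite /upd eqxx. Qed.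

Lemma updK m (x : 'I_m -> V) i : upd x i (x i) = x.
Proof. by apply/funext => j; rewrite /upd; case: eqP => [->|]. Qed.

Lemma upd_upd m (x : 'I_m -> V) i w w' : upd (upd x i w) i w' = upd x i w'.
Proof. by apply/funext => j; rewrite /upd; case: eqP. Qed.

Lemma big_unlift m (i0 : 'I_m.+1) (G : 'I_m.+1 -> V) :
  \sum_j G j = G i0 + \sum_i G (lift i0 i).
Proof.
rewrite (bigD1 i0) //=; congr (_ + _).
rewrite (reindex_omap (lift i0) (unlift i0)) /=; last first.
  by move=> j; rewrite eq_sym => /unlift_some[k -> ->].
by apply: eq_bigl => i; rewrite eq_sym neq_lift liftK eqxx.
Qed.

Lemma big_perm_fix m (i0 : 'I_m.+1) (F : 'S_m.+1 -> V) :
  \sum_(s : 'S_m.+1 | s i0 == i0) F s = \sum_(s : 'S_m) F (lift_perm i0 i0 s).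
Proof.
have injl : injective (@lift_perm m i0 i0).
  move=> s t st; apply/permP => k; apply: (@lift_inj _ i0).
  by rewrite -!(lift_perm_lift i0 i0) st.
transitivity (\sum_(s in @lift_perm m i0 i0 @: [set: 'S_m]%SET) F s).
  apply: eq_bigl => s; apply/eqP/imsetP => [si0|[t _ ->]]; last exact: lift_perm_id.
  have tK k : lift i0 (odflt k (unlift i0 (s (lift i0 k)))) = s (lift i0 k).
    case: unliftP => [j -> //|e] /=.
    have /eqP : lift i0 k = i0 by apply: (@perm_inj _ s); rewrite e si0.
    by rewrite eq_sym (negbTE (neq_lift i0 k)).
  have tI : injective (fun k => odflt k (unlift i0 (s (lift i0 k)))).
    by move=> k l /(congr1 (lift i0)); rewrite !tK => /perm_inj/lift_inj.
  exists (perm tI); first by rewrite !inE.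
  apply/permP => k; case: (unliftP i0 k) => [j|] ->; last by rewrite lift_perm_id.
  by rewrite lift_perm_lift permE tK.
rewrite big_imset; last by move=> s t _ _; exact: injl.
by apply: eq_bigl => s; rewrite !inE.
Qed.

Lemma big_perm_unlift m (i0 : 'I_m.+1) (F : 'S_m.+1 -> V) :
  \sum_s F s = \sum_j \sum_(s : 'S_m) F (lift_perm i0 i0 s * tperm i0 j)%g.
Proof.
rewrite (partition_big (fun s : 'S_m.+1 => s i0) predT) //=.
apply: eq_bigr => j _; rewrite (reindex_inj (mulIg (tperm i0 j))) /=.
rewrite -(big_perm_fix i0 (fun s => F (s * tperm i0 j)%g)).
apply: eq_bigl => s; rewrite permM; apply/eqP/eqP => [e|->]; last exact: tpermL.
by apply: (@perm_inj _ (tperm i0 j)); rewrite e tpermL.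
Qed.

Definition insert m (i0 : 'I_m.+1) (x : 'I_m -> V) w : 'I_m.+1 -> V :=
  fun k => if unlift i0 k is Some i then x i else w.

Lemma insert_tperm m (i0 : 'I_m.+1) (x : 'I_m -> V) w i k :
  insert i0 x w (tperm i0 (lift i0 i) (lift i0 k)) = upd x i w k.
Proof.
rewrite /insert /upd; case: (eqVneq k i) => [->|ki].
  by rewrite tpermR unlift_none.
by rewrite tpermD ?neq_lift ?(inj_eq lift_inj) 1?eq_sym // liftK.
Qed.

Lemma symf_last m y (x : 'I_m -> V) w :
  symf y (insert ord_max x w) =
    symf y x * (y m * w) + \sum_i symf y (upd x i w) * (y m * x i).
Proof.
rewrite /symf (big_perm_unlift ord_max) (big_unlift ord_max).
have wl k : widen_ord (leqnSn m) k = lift ord_max k.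
  by apply: val_inj; rewrite /= /bump leqNgt ltn_ord.
congr (_ + _).
  rewrite mulr_suml; apply: eq_bigr => s _; rewrite big_ord_recr /=; congr (_ * _).
    by apply: eq_bigr => k _; rewrite wl tperm1 mulg1 lift_perm_lift /insert liftK.
  by rewrite tperm1 mulg1 lift_perm_id /insert unlift_none.
apply: eq_bigr => i _.
rewrite mulr_suml; apply: eq_bigr => s _; rewrite big_ord_recr /=; congr (_ * _).
  by apply: eq_bigr => k _; rewrite wl permM lift_perm_lift insert_tperm.
by rewrite permM lift_perm_id tpermL /insert liftK.
Qed.

Lemma symf_first m y (x : 'I_m -> V) w :
  symf y (insert ord0 x w) =
    y 0%N * w * symf (y \o S) x + \sum_i y 0%N * x i * symf (y \o S) (upd x i w).
Proof.
rewrite /symf (big_perm_unlift ord0) (big_unlift ord0).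
congr (_ + _).
  rewrite mulr_sumr; apply: eq_bigr => s _; rewrite big_ord_recl /=; congr (_ * _).
    by rewrite tperm1 mulg1 lift_perm_id /insert unlift_none.
  by apply: eq_bigr => k _; rewrite tperm1 mulg1 lift_perm_lift /insert liftK.
apply: eq_bigr => i _.
rewrite mulr_sumr; apply: eq_bigr => s _; rewrite big_ord_recl /=; congr (_ * _).
  by rewrite permM lift_perm_id tpermL /insert liftK.
by apply: eq_bigr => k _; rewrite permM lift_perm_lift insert_tperm.
Qed.

Lemma symf_slot m y (x : 'I_m -> V) i :
  exists t : seq (V * V), forall w, symf y (upd x i w) = \sum_(c <- t) c.1 * w * c.2.
Proof.
suff H (s : 'S_m) : exists c : V * V,
    forall w, \prod_(k < m) (y k * upd x i w (s k)) = c.1 * w * c.2.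
  have [c hc] := choice H.
  exists [seq c s | s <- index_enum _] => w; rewrite big_map.
  by apply: eq_bigr => s _; rewrite hc.
pose j := (s^-1)%g i.
have sj : s j = i by rewrite /j permKV.
have jin : j \in index_enum 'I_m by rewrite mem_index_enum.
have := index_enum_uniq 'I_m.
case/splitPr: jin => l1 l2.
rewrite cat_uniq /= negb_or => /and3P[_ /andP[j1 _] /andP[j2 _]].
exists (\prod_(k <- l1) (y k * x (s k)) * y j, \prod_(k <- l2) (y k * x (s k))) => w /=.
rewrite big_cat big_cons /= sj upd_id !mulrA; congr (_ * _ * _ * _).
- apply: eq_big_seq => k kl; rewrite /upd -sj (inj_eq perm_inj).
  by case: eqP kl j1 => // -> ->.
- apply: eq_big_seq => k kl; rewrite /upd -sj (inj_eq perm_inj).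
  by case: eqP kl j2 => // -> ->.
Qed.

End SymmetricForms.

Lemma sum_sign_superset (V : nzRingType) (T : finType) (P : pred {set T}) (i0 : T) :
  (forall S : {set T}, P (i0 |: S) = P S) ->
  \sum_(S | P S) (-1) ^+ #|S| = 0 :> V.
Proof.
move=> hP; rewrite (bigID (fun S : {set T} => i0 \in S)) /=.
rewrite (reindex_onto (fun S => i0 |: S) (fun S => S :\ i0)) /=; last first.
  by move=> S /andP[_ iS]; rewrite finset.setD1K.
rewrite (eq_bigl (fun S => P S && (i0 \notin S))); last first.
  move=> S; rewrite finset.setU11 andbT hP; congr (_ && _).
  apply/eqP/idP => [<-|iS]; first by rewrite !inE eqxx.
  by rewrite finset.setU1K.
rewrite -big_split /= big1 // => S /andP[_ iS].
by rewrite cardsU1 iS exprS mulN1r addNr.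
Qed.

Lemma symf_polarization (V : nzRingType) (m : nat) (y : nat -> V) (x : 'I_m -> V) :
  \sum_(S : {set 'I_m}) (-1) ^+ #|S| * \prod_(k < m) (y k * \sum_(i in S) x i)
    = (-1) ^+ m * symf y x.
Proof.
pose F (f : {ffun 'I_m -> 'I_m}) := \prod_(k < m) (y k * x (f k)).
transitivity (\sum_f \sum_(S : {set 'I_m} | f \in ffun_on (mem S)) (-1) ^+ #|S| * F f).
  rewrite (exchange_big_dep predT) //=; apply: eq_bigr => S _.
  rewrite -mulr_sumr; congr (_ * _).
  rewrite -(bigA_distr_big (mem S) (fun (k i : 'I_m) => y k * x i)).
  by apply: eq_bigr => k _; rewrite mulr_sumr.
rewrite (bigID (fun f : {ffun 'I_m -> 'I_m} => injectiveb f)) /= addrC big1 ?add0r => [|f Uf].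
  rewrite (reindex (@pval _)) /=; last first.
    pose in_Sn := insubd (1%g : 'S_m).
    by exists in_Sn => /= f Uf; first apply: val_inj; apply: insubdK.
  rewrite /symf mulr_sumr; apply: eq_big => /= [s | s _]; rewrite ?(valP s) //.
  rewrite (big_pred1 [set: 'I_m]%SET) => [|S]; last first.
    apply/ffun_onP/eqP => [H|-> i]; last by rewrite inE.
    apply/setP => i; rewrite inE; have := H ((s^-1)%g i).
    by rewrite pvalE permKV.
  rewrite cardsT card_ord; congr (_ * _); apply: eq_bigr => k _; congr (_ * x _).
  by rewrite pvalE.
rewrite -mulr_suml.
have [i0 hi0] : exists i0, i0 \notin codom f.
  apply/existsP; apply: contraNT Uf => /existsPn H.
  apply/injectiveP; apply: in2T; apply/image_injP/eqP.
  by apply: eq_card => i; move/negPn: (H i) => ->.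
rewrite (@sum_sign_superset _ _ _ i0) ?mul0r // => S.
apply/ffun_onP/ffun_onP => H k; have := H k; rewrite !inE; last by move->; rewrite orbT.
by case/orP => // /eqP fk; rewrite -fk codom_f in hi0.
Qed.

Lemma symf_vanish (V : nzRingType) (R : set V) (m : nat) : subgrp R ->
  (forall (y : nat -> V) z, R z -> \prod_(k < m) (y k * z) = 0) ->
  forall y (x : 'I_m -> V), (forall i, R (x i)) -> symf y x = 0.
Proof.
move=> sR H y x Rx; have := symf_polarization y x.
rewrite big1 => [/esym/(congr1 ( *%R ((-1) ^+ m)))|S _].
  by rewrite mulrA -expr2 sqrr_sign mul1r mulr0.
by rewrite H ?mulr0 //; apply: subgrp_sum.
Qed.

(** * Nil rings of bounded index *)

Section Symmetries.
Variable V : nzRingType.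
Implicit Types (G : set (V -> V)) (K R : set V).

Definition autgroup G := forall g, G g ->
  [/\ {morph g : x y / x - y}, {morph g : x y / x * y} &
      exists h, [/\ G h, cancel g h & cancel h g]].

Definition invariant G K := forall g x, G g -> K x -> K (g x).

(* The only consequence of oligomorphy that is needed; unlike finiteness of the
   number of orbits, it passes to subquotients without any choice of representatives. *)
Definition oligomorphic G R := forall X : nat -> V -> V -> V -> Prop,
  (forall n a b c, X n a b c -> X n.+1 a b c) ->
  (forall g n a b c, G g -> X n a b c -> X n (g a) (g b) (g c)) ->
  (forall a b c, R a -> R b -> R c -> exists n, X n a b c) ->
  exists n, forall a b c, R a -> R b -> R c -> X n a b c.

Lemma oligomorphic1 G R (X : nat -> V -> Prop) : oligomorphic G R ->
  (forall n a, X n a -> X n.+1 a) ->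
  (forall g n a, G g -> X n a -> X n (g a)) ->
  (forall a, R a -> exists n, X n a) -> exists n, forall a, R a -> X n a.
Proof.
move=> oG mX iX cX.
have [n hn] := oG (fun n a _ _ => X n a) (fun n a _ _ => mX n a)
  (fun g n a _ _ => iX g n a) (fun a _ _ Ra _ _ => cX a Ra).
by exists n => a Ra; exact: (hn a a a).
Qed.

End Symmetries.

Section NilBounded.
Variables (V : nzRingType) (R : set V).
Hypothesis idR : ideal2 R.

Let Rl u x : R x -> R (u * x). Proof. by case: idR => _ h _; exact: h. Qed.
Let Rr u x : R x -> R (x * u). Proof. by case: idR => _ _ h; exact: h. Qed.
Let Rg : subgrp R. Proof. by case: idR. Qed.

(* If [c := (b * x) ^+ e.+1 * b] is nonzero, then [c] satisfies the hypothesis with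
   [e] in place of [e.+1]: expand [(b * u) ^+ e.+2 * b] for [u := w * b * y + w],
   where [b * w * b = c] and [b * w * b * w * b = 0]. *)
Lemma nil_bounded_descent (e : nat) (b : V) : R b -> b != 0 ->
  (forall x, R x -> (b * x) ^+ e.+1 * b = 0) ->
  exists z, [/\ R z, z != 0 & forall x, R x -> z * x * z = 0].
Proof.
elim: e b => [|e IH] b Rb b0 hb; first by exists b; split => // x /hb; rewrite expr1.
case: (pselect (forall x, R x -> (b * x) ^+ e.+1 * b = 0)) => [/IH|]; first exact.
move/existsNP => [x] /not_implyP[Rx /eqP c0].
set c := (b * x) ^+ e.+1 * b in c0.
have Rc : R c by apply: Rl.
apply: (IH c) => // y Ry.
pose w := (x * b) ^+ e * x.
have bxb n : b * (x * b) ^+ n = (b * x) ^+ n * b.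
  elim: n => [|n IHn]; first by rewrite !expr0 mulr1 mul1r.
  by rewrite exprSr mulrA IHn exprSr !mulrA.
have bw : b * w = (b * x) ^+ e.+1 by rewrite /w mulrA bxb -(mulrA _ b) -exprSr.
have bwbwb : b * w * (b * w * b) = 0.
  by rewrite bw mulrA -exprD addSnnS exprD -mulrA hb // mulr0.
have bwb : b * w * b = c by rewrite bw.
pose P := c * y; pose W := b * w.
have WP : W * P = 0 by rewrite /P mulrA -bwb bwbwb mul0r.
have hW k : W * (P + W) ^+ k.+1 * b = 0.
  elim: k => [|k IHk]; first by rewrite expr1 mulrDr WP add0r -mulrA bwbwb.
  by rewrite exprS mulrA mulrDr WP add0r -mulrA -mulrA [W * (_ * b)]mulrA IHk mulr0.
have hP k : (P + W) ^+ k.+1 * b = P ^+ k.+1 * b + P ^+ k * W * b.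
  elim: k => [|k IHk]; first by rewrite !expr1 expr0 mul1r mulrDl.
  by rewrite exprS mulrDl mulrDl hW addr0 -mulrA IHk mulrDr !mulrA -!exprS.
have : (b * (w * b * y + w)) ^+ e.+2 * b = 0.
  by apply: hb; apply: subgrpD => //; [apply: Rl | apply: Rl].
rewrite mulrDr [b * (_ * y)]mulrA [b * (w * b)]mulrA bwb -/P -/W hP.
have -> : P ^+ e.+2 * b = 0.
  rewrite /P -bwb -[b * w * b * y]mulrA -[b * w * _]mulrA; apply: hb.
  by apply: Rl; apply: Rl.
by rewrite add0r -mulrA bwb.
Qed.

Fixpoint kills (n : nat) (z a : V) : Prop :=
  if n is n'.+1 then forall u, kills n' z (a * u * z) else a = 0.

Lemma kills_subgrp n z : subgrp (kills n z).
Proof.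
elim: n => [|n [h0 hB]]; first by split => //= x y -> ->; rewrite subrr.
by split=> [u|x y hx hy u]; rewrite /= ?mul0r // mulrBl mulrBl; exact: hB.
Qed.

Lemma kills_mull n z u a : kills n z a -> kills n z (u * a).
Proof.
elim: n a => [|n IH] a; first by move=> /= ->; rewrite mulr0.
by move=> ha v /=; rewrite -!mulrA; apply: IH; rewrite mulrA.
Qed.

Lemma kills_mulr n z u a : kills n z a -> kills n z (a * u).
Proof.
case: n => [/= ->|n ha v]; first by rewrite mul0r.
by rewrite -(mulrA a); exact: ha.
Qed.

Lemma killsS n z a : kills n z a -> kills n.+1 z a.
Proof.
elim: n a => [|n IH] a; first by move=> /= -> u; rewrite !mul0r.
by move=> ha u; apply: IH.
Qed.

Lemma kills_le n n' z a : (n <= n')%N -> kills n z a -> kills n' z a.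
Proof.
by move=> /subnKC <-; elim: (n' - n)%N => [|k IH]; rewrite ?addn0 // addnS => /IH/killsS.
Qed.

Lemma kills_prod m z a (y : nat -> V) : kills m z a -> a * \prod_(k < m) (y k * z) = 0.
Proof.
elim: m a y => [|m IH] a y; first by move=> /= ->; rewrite mul0r.
by move=> ha; rewrite big_ord_recl mulrA (mulrA a) (IH _ (y \o S)).
Qed.

Definition abs_zdiv z := R z /\ forall u, z * u * z = 0.

Lemma kills_addr z' z i a : kills i z' a -> (forall u, a * u * z = 0) ->
  kills i (z' + z) a.
Proof.
elim: i a => [//|i IH] a ha az u; rewrite mulrDr az addr0.
by apply: IH => // v; rewrite -(az (u * z' * v)) !mulrA.
Qed.

Lemma kills_abs_zdiv z' z n : abs_zdiv z -> kills n z' 1 ->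
  forall i a, kills i z' a -> kills (n + i) (z' + z) a.
Proof.
move=> [_ hz] h1; elim=> [|i IH] a; first by move=> /= ->; exact: (kills_subgrp _ _).1.
move=> ha; rewrite addnS => u; rewrite mulrDr; apply: (subgrpD (kills_subgrp _ _)).
  exact: IH.
apply: (kills_le (leq_addr i n)); apply: kills_addr.
  by rewrite -(mulr1 (a * u * z)); apply: kills_mull.
by move=> v; rewrite -(mulr0 (a * u)) -(hz v) !mulrA.
Qed.

Lemma abs_zdivN z : abs_zdiv z -> abs_zdiv (- z).
Proof.
move=> [Rz hz]; split; first exact: subgrpN.
by move=> u; rewrite mulrN !mulNr hz !oppr0.
Qed.

Lemma kills_addspan z : addspan abs_zdiv z -> exists n, kills n z 1.
Proof.
pose E z := exists n, kills n z 1.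
have step z1 z2 : abs_zdiv z2 -> E z1 -> E (z1 + z2).
  by move=> hz [n hn]; exists (n + n)%N; apply: kills_abs_zdiv.
move=> hz; suff /(_ 0) : forall z', E z' <-> E (z' + z).
  by rewrite add0r => -[+ _]; apply; exists 1%N => u; rewrite /= mulr0.
apply: (hz [set z | forall z', E z' <-> E (z' + z)]).
  split=> /= [z'|x y hx hy z']; first by rewrite addr0.
  rewrite addrCA addrC; split=> [h|/(hx _).2/(hy _).1]; last by rewrite subrK.
  by apply/(hx _).1/(hy _).2; rewrite subrK.
move=> x ax z'; split; first exact: step.
by move=> /(step _ _ (abs_zdivN ax)); rewrite addrK.
Qed.

End NilBounded.

(** * Rings without invariant ideals *)

Section Simple.
Variables (V : nzRingType) (G : set (V -> V)) (R : set V).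

Definition simple_idempotent :=
  [/\ ideal2 R, invariant G R, exists r, R r /\ r != 0,
      forall K, subgrp K -> (forall a b, R a -> R b -> K (a * b)) -> R `<=` K &
      forall K, ideal2 K -> invariant G K -> K `<=` R ->
        (exists x, K x /\ x != 0) -> R `<=` K].

Hypotheses (aG : autgroup G) (sR : simple_idempotent).

Lemma simple_ideal : ideal2 R. Proof. by case: sR. Qed.
Let idR := simple_ideal.

Lemma simple_mull u x : R x -> R (u * x). Proof. by case: idR => _ h _; exact: h. Qed.
Lemma simple_mulr u x : R x -> R (x * u). Proof. by case: idR => _ _ h; exact: h. Qed.
Lemma simple_subgrp : subgrp R. Proof. by case: idR. Qed.

Lemma aut_facts g : G g ->
  [/\ g 0 = 0, g 1 = 1, {morph g : x y / x + y} & forall K, subgrp K -> subgrp (g @^-1` K)].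
Proof.
move=> Gg; have [gB gM [h [Gh gh hg]]] := aG Gg.
have g0 : g 0 = 0 by rewrite -[in LHS](subrr 0) gB subrr.
split=> //.
- by rewrite -[LHS]mulr1 -[X in _ * X]hg -gM mul1r hg.
- move=> x y; have gN : g (- y) = - g y by rewrite -sub0r gB g0 sub0r.
  by rewrite -[y in LHS]opprK gB gN opprK.
- by move=> K [K0 KB]; split=> [|x y]; rewrite /preimage /= ?g0 // gB; exact: KB.
Qed.

Lemma left_ann0 a : R a -> (forall r, R r -> a * r = 0) -> a = 0.
Proof.
have [_ iR [r0 [Rr0 r00]] RR simp] := sR.
move=> Ra ha; apply: contrapT => /eqP a0; case/eqP: r00.
pose K := [set a | R a /\ forall r, R r -> a * r = 0].
have RK : R `<=` K.
  apply: simp; last by exists a.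
  - split; first split; first by split; [exact: simple_subgrp.1 | move=> r _; rewrite mul0r].
    + move=> x y [Rx hx] [Ry hy]; split; first exact: simple_subgrp.2.
      by move=> r Rr; rewrite mulrBl hx // hy // subrr.
    + by move=> u x [Rx hx]; split=> [|r Rr]; [exact: simple_mull | rewrite -mulrA hx // mulr0].
    + move=> u x [Rx hx]; split=> [|r Rr]; first exact: simple_mulr.
      by rewrite -mulrA hx //; exact: simple_mull.
  - move=> g x Gg [Rx hx]; split=> [|r Rr]; first exact: iR.
    have [gB gM [h [Gh gh hg]]] := aG Gg; have [g0 _ _ _] := aut_facts Gg.
    by rewrite -(hg r) -gM hx ?g0 //; exact: iR.
  - by move=> x [].
apply: (RR [set 0]) Rr0 => /=; first by split=> //= x y -> ->; rewrite subrr.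
by move=> x y /RK[_ +] Ry; apply.
Qed.

Lemma right_ann0 a : R a -> (forall r, R r -> r * a = 0) -> a = 0.
Proof.
have [_ iR [r0 [Rr0 r00]] RR simp] := sR.
move=> Ra ha; apply: contrapT => /eqP a0; case/eqP: r00.
pose K := [set a | R a /\ forall r, R r -> r * a = 0].
have RK : R `<=` K.
  apply: simp; last by exists a.
  - split; first split; first by split; [exact: simple_subgrp.1 | move=> r _; rewrite mulr0].
    + move=> x y [Rx hx] [Ry hy]; split; first exact: simple_subgrp.2.
      by move=> r Rr; rewrite mulrBr hx // hy // subrr.
    + move=> u x [Rx hx]; split=> [|r Rr]; first exact: simple_mull.
      by rewrite mulrA hx //; exact: simple_mulr.
    + by move=> u x [Rx hx]; split=> [|r Rr]; [exact: simple_mulr | rewrite mulrA hx // mul0r].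
  - move=> g x Gg [Rx hx]; split=> [|r Rr]; first exact: iR.
    have [gB gM [h [Gh gh hg]]] := aG Gg; have [g0 _ _ _] := aut_facts Gg.
    by rewrite -(hg r) -gM hx ?g0 //; exact: iR.
  - by move=> x [].
apply: (RR [set 0]) Rr0 => /=; first by split=> //= x y -> ->; rewrite subrr.
by move=> x y Rx /RK[_ +]; apply.
Qed.

Lemma addspan_generates (S : set V) :
  (forall u x, S x -> S (u * x)) -> (forall u x, S x -> S (x * u)) ->
  invariant G S -> S `<=` R -> (exists x, S x /\ x != 0) -> R `<=` addspan S.
Proof.
have [_ iR _ _ simp] := sR.
move=> Sl Sr iS SR [x [Sx x0]]; apply: simp.
- exact: addspan_ideal.
- move=> g z Gg; have [gB _ _] := aG Gg; apply: (addspan_map gB) => {}z Sz.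
  by apply: addspan_sub; apply: iS.
- exact: addspan_le simple_subgrp SR.
- by exists x; split=> //; exact: addspan_sub.
Qed.

Variables (Q : nat).
Hypotheses (nilR : forall x, R x -> x ^+ Q = 0) (oR : oligomorphic G R).

Lemma abs_zdiv_generates : R `<=` addspan (abs_zdiv R).
Proof.
have [_ iR [r0 [Rr0 r00]] RR simp] := sR.
apply: addspan_generates.
- move=> u x [Rx hx]; split=> [|v]; first exact: simple_mull.
  by rewrite -(mulr0 u) -(hx (v * u)) !mulrA.
- move=> u x [Rx hx]; split=> [|v]; first exact: simple_mulr.
  by rewrite -(mul0r u) -(hx (u * v)) !mulrA.
- move=> g x Gg [Rx hx]; split=> [|u]; first exact: iR.
  have [_ gM [h [Gh gh hg]]] := aG Gg; have [g0 _ _ _] := aut_facts Gg.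
  by rewrite -(hg u) -!gM hx.
- by move=> x [].
have [b [Rb b0 hb]] : exists z, [/\ R z, z != 0 & forall x, R x -> z * x * z = 0].
  apply: (@nil_bounded_descent _ _ idR Q r0) => // x Rx.
  by rewrite exprS nilR ?mulr0 ?mul0r //; exact: simple_mull.
have [s [Rs bs]] : exists s, R s /\ b * s != 0.
  apply: contrapT => /forallNP H; move/eqP: b0; apply; apply: left_ann0 => // r Rr.
  by apply: contrapT => /eqP br; apply: (H r).
have [r [Rr rbs]] : exists r, R r /\ r * (b * s) != 0.
  apply: contrapT => /forallNP H; move/eqP: bs; apply.
  apply: right_ann0 => [|r Rr]; first exact: simple_mull.
  by apply: contrapT => /eqP br; apply: (H r).
exists (r * (b * s)); split=> //; split=> [|u]; first by apply: simple_mull; exact: simple_mull.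
have := hb (s * u * r); move/(_ (simple_mull _ Rr)) => h.
by rewrite -(mulr0 r) -(mul0r s) -h !mulrA.
Qed.

Lemma uniform_kills : exists C, forall z, R z -> kills C z 1.
Proof.
suff [C hC] : exists C, forall z, R z -> forall a, kills C z a by exists C => z /hC; apply.
apply: (oligomorphic1 oR) => [n a h b|g n a Gg h b|a Ra]; first exact: killsS.
  have [_ gM [k [Gk gk kg]]] := aG Gg; have [g0 _ _ _] := aut_facts Gg.
  rewrite -(kg b); move: (k b) (h (k b)) => {h}c; elim: n c => [|n IH] c /=.
    by move=> ->.
  by move=> hc u; rewrite -(kg u) -!gM; apply: IH.
have [n hn] := kills_addspan idR (abs_zdiv_generates Ra).
by exists n => b; rewrite -(mulr1 b); apply: kills_mull.
Qed.

Lemma maximal_form : exists m,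
  (exists y (x : 'I_m.+1 -> V), (forall i, R (x i)) /\ symf y x != 0) /\
  (forall y (x : 'I_m.+2 -> V), (forall i, R (x i)) -> symf y x = 0).
Proof.
have [_ _ [r0 [Rr0 r00]] _ _] := sR; have [C hC] := uniform_kills.
pose P m := exists y (x : 'I_m -> V), (forall i, R (x i)) /\ symf y x != 0.
have P1 : `[< P 1%N >].
  apply/asboolP; exists (fun=> 1), (fun=> r0); split=> //.
  rewrite /symf (big_pred1 1%g) ?big_ord1 ?mul1r // => s /=.
  by apply/esym/eqP/permP => i; rewrite !ord1.
have PC m : `[< P m >] -> (m <= C)%N.
  move=> /asboolP[y [x [Rx /eqP]]]; case: leqP => // Cm; case.
  apply: (symf_vanish simple_subgrp) => // {}y z Rz.
  by have := kills_prod y (kills_le (ltnW Cm) (hC _ Rz)); rewrite mul1r.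
have [m /asboolP Pm mmax] := ex_maxnP (ex_intro (fun m => `[< P m >]) _ P1) PC.
have m0 : (0 < m)%N by apply: mmax.
case: m m0 Pm mmax => // m _ Pm mmax; exists m; split=> // y x Rx.
apply: contrapT => /eqP h; suff : (m.+2 <= m.+1)%N by rewrite ltnn.
by apply: mmax; apply/asboolP; exists y, x.
Qed.

End Simple.

(** * Exchange identities *)

Section MultiplicationMaps.
Variable V : nzRingType.

Definition multmap (g : V -> V) :=
  exists t : seq (V * V), forall w, g w = \sum_(c <- t) c.1 * w * c.2.

Lemma multmap_mulr g c : multmap g -> multmap (fun w => g w * c).
Proof.
move=> [t ht]; exists [seq (d.1, d.2 * c) | d <- t] => w.
by rewrite big_map ht mulr_suml; apply: eq_bigr => d _; rewrite mulrA.
Qed.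

Lemma multmap_mull g c : multmap g -> multmap (fun w => c * g w).
Proof.
move=> [t ht]; exists [seq (c * d.1, d.2) | d <- t] => w.
by rewrite big_map ht mulr_sumr; apply: eq_bigr => d _; rewrite !mulrA.
Qed.

Lemma multmap_comp g a b : multmap g -> multmap (fun w => g (a * w * b)).
Proof.
move=> [t ht]; exists [seq (d.1 * a, b * d.2) | d <- t] => w.
by rewrite big_map ht; apply: eq_bigr => d _; rewrite !mulrA.
Qed.

Lemma multmap_sum g (I : Type) (r : seq I) (P : pred I) F : multmap g ->
  g (\sum_(i <- r | P i) F i) = \sum_(i <- r | P i) g (F i).
Proof.
move=> [t ht]; rewrite ht; under [RHS]eq_bigr do rewrite ht.
by rewrite exchange_big; apply: eq_bigr => c _; rewrite mulr_sumr mulr_suml.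
Qed.

Lemma multmap_slot m y (x : 'I_m -> V) i : multmap (fun w => symf y (upd x i w)).
Proof. exact: symf_slot. Qed.

End MultiplicationMaps.

Section Exchange.
Variables (V : nzRingType) (G : set (V -> V)) (R : set V).
Hypotheses (aG : autgroup G) (sR : simple_idempotent G R).
Variable m : nat.
Hypothesis van : forall y (x : 'I_m.+2 -> V), (forall i, R (x i)) -> symf y x = 0.

Implicit Types (x : 'I_m.+1 -> V) (y : nat -> V).

Let inR x := forall i, R (x i).

Lemma upd_in x i w : inR x -> R w -> inR (upd x i w).
Proof. by move=> Rx Rw j; rewrite /upd; case: eqP. Qed.

Lemma insert_in (i0 : 'I_m.+2) x w : inR x -> R w -> forall i, R (insert i0 x w i).
Proof. by move=> Rx Rw i; rewrite /insert; case: unlift. Qed.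

Lemma symf_in y x : inR x -> R (symf y x).
Proof.
have Rl := simple_mull sR; have Rr := simple_mulr sR; have Rg := simple_subgrp sR.
move=> Rx; apply: subgrp_sum => // s _; rewrite big_ord_recl.
by apply: Rr; exact: Rl.
Qed.

Lemma symf_generates y0 x0 : inR x0 -> symf y0 x0 != 0 ->
  R `<=` addspan [set z | exists u v y x, inR x /\ z = u * symf y x * v].
Proof.
have iR : invariant G R by case: sR.
move=> Rx0 f0; apply: (addspan_generates aG sR).
- by move=> u _ [u' [v [y' [X [RX ->]]]]]; exists (u * u'), v, y', X; rewrite !mulrA.
- by move=> u _ [u' [v [y' [X [RX ->]]]]]; exists u', (v * u), y', X; rewrite !mulrA.
- move=> g _ Gg [u [v [y' [X [RX ->]]]]].
  have [gB gM _] := aG Gg; have [g0 g1 gD _] := aut_facts aG Gg.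
  exists (g u), (g v), (g \o y'), (g \o X); split; first by move=> i; exact: iR.
  rewrite !gM /symf (big_morph g gD g0); congr (_ * _ * _).
  apply: eq_bigr => s _; rewrite (big_morph g gM g1).
  by apply: eq_bigr => k _; rewrite gM.
- move=> _ [u [v [y' [X [RX ->]]]]]; apply: (simple_mulr sR).
  by apply: (simple_mull sR); exact: symf_in.
- by exists (symf y0 x0); split=> //; exists 1, 1, y0, x0; rewrite mul1r mulr1.
Qed.

Lemma symf_ext n y y' (x : 'I_n -> V) :
  (forall k, (k < n)%N -> y k = y' k) -> symf y x = symf y' x.
Proof.
by move=> yy; apply: eq_bigr => s _; apply: eq_bigr => k _; rewrite yy.
Qed.

Lemma symf_mull c y x :
  c * symf y x = symf (fun k => if k is 0%N then c * y 0%N else y k) x.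
Proof.
rewrite /symf mulr_sumr; apply: eq_bigr => s _.
by rewrite !big_ord_recl !mulrA.
Qed.

Lemma exchange_left y x g : inR x -> multmap g -> forall w, R w ->
  symf y x * g w + \sum_i symf y (upd x i w) * g (x i) = 0.
Proof.
move=> Rx [t ht] w Rw.
have H c : symf y x * (c * w) + \sum_i symf y (upd x i w) * (c * x i) = 0.
  pose y' k := if k == m.+1 then c else y k.
  have e n (z : 'I_n -> V) : (n <= m.+1)%N -> symf y z = symf y' z.
    move=> nm; apply: symf_ext => k kn; rewrite /y' ifN // neq_ltn.
    by rewrite (leq_trans kn nm).
  have := van y' (insert_in ord_max Rx Rw); rewrite symf_last.
  have -> : y' m.+1 = c by rewrite /y' eqxx.
  by rewrite -e //; under eq_bigr do rewrite -e //.
rewrite ht mulr_sumr; under [X in _ + X]eq_bigr do rewrite ht mulr_sumr.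
rewrite exchange_big -big_split big1 //= => c _.
rewrite -[RHS](mul0r c.2) -[in RHS](H c.1) mulrDl mulr_suml !mulrA; congr (_ + _).
by apply: eq_bigr => i _; rewrite !mulrA.
Qed.

Lemma exchange_right y x g : inR x -> multmap g -> forall w, R w ->
  g w * symf y x + \sum_i g (x i) * symf y (upd x i w) = 0.
Proof.
move=> Rx [t ht] w Rw.
have H c : w * c * symf y x + \sum_i x i * c * symf y (upd x i w) = 0.
  pose y' k := if k is k'.+1 then (if k' is 0%N then c * y 0%N else y k') else 1.
  have := van y' (insert_in ord0 Rx Rw); rewrite symf_first /= => h.
  rewrite -[RHS]h mul1r -mulrA symf_mull; congr (_ + _).
  by apply: eq_bigr => i _; rewrite mul1r -mulrA symf_mull.
rewrite ht mulr_suml; under [X in _ + X]eq_bigr do rewrite ht mulr_suml.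
rewrite exchange_big -big_split big1 //= => c _.
rewrite -[RHS](mulr0 c.1) -[in RHS](H c.2) mulrDr mulr_sumr !mulrA; congr (_ + _).
by apply: eq_bigr => i _; rewrite !mulrA.
Qed.

Lemma exchange_inner L y x w : multmap L -> inR x -> R w ->
  L (symf y x) * w + \sum_i L (symf y (upd x i w)) * x i = 0.
Proof.
move=> [t ht] Rx Rw; rewrite ht mulr_suml.
under [X in _ + X]eq_bigr do rewrite ht mulr_suml.
rewrite exchange_big -big_split big1 //= => c _.
have hM : multmap (fun w => c.2 * w).
  by exists [:: (c.2, 1)] => v; rewrite big_seq1 mulr1.
rewrite -[RHS](mulr0 c.1) -[in RHS](exchange_left y Rx hM Rw) mulrDr mulr_sumr !mulrA.
by congr (_ + _); apply: eq_bigr => i _; rewrite !mulrA.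
Qed.

Definition form_trace a b y x := \sum_i symf y (upd x i (a * x i * b)).

(* Exchange [x i] with the letters of [x'] on the left hand side and [a * x' j * b]
   with the letters of [x] on the right hand side: the results coincide. *)
Lemma form_traceC a b c y x y' x' : inR x -> inR x' ->
  form_trace a b y x * c * symf y' x' = symf y x * c * form_trace a b y' x'.
Proof.
have Rl := simple_mull sR; have Rr := simple_mulr sR.
move=> Rx Rx'; rewrite /form_trace 2!mulr_suml [RHS]mulr_sumr.
transitivity (- \sum_i \sum_j symf y (upd x i (a * x' j * b)) * c
                               * symf y' (upd x' j (x i))).
  rewrite -sumrN; apply: eq_bigr => i _; apply/eqP; rewrite -addr_eq0; apply/eqP.
  apply: (exchange_right y' Rx' (g := fun w => symf y (upd x i (a * w * b)) * c)) => //.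
  exact: (multmap_mulr c (multmap_comp a b (multmap_slot y x i))).
rewrite exchange_big -sumrN; apply: eq_bigr => j _; apply/esym/eqP.
rewrite -addr_eq0; apply/eqP.
rewrite -[RHS](exchange_left y Rx (g := fun w => c * symf y' (upd x' j w)) _
  (w := a * x' j * b)) ?mulrA //.
- by congr (_ + _); apply: eq_bigr => i _; rewrite mulrA.
- exact: (multmap_mull c (multmap_slot y' x' j)).
- by apply: Rr; exact: Rl.
Qed.

Lemma upd_comm n (x : 'I_n -> V) i j w w' : i != j ->
  upd (upd x i w) j w' = upd (upd x j w') i w.
Proof.
move=> ij; apply/funext => k; rewrite /upd.
by case: (eqVneq k j) => // ->; rewrite eq_sym (negPf ij).
Qed.

(* The operator [w |-> al * symf y' (upd X 0 w) * be] behaves like one of rank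
   one; if all traces [form_trace a b] vanished, its trace would force [symf] to vanish. *)
Lemma trace_nondegenerate y x : inR x -> symf y x != 0 ->
  exists a b y' x', [/\ R a, inR x' & form_trace a b y' x' != 0].
Proof.
have Rl := simple_mull sR; have Rr := simple_mulr sR; have Rg := simple_subgrp sR.
have RR : forall K, subgrp K -> (forall a b, R a -> R b -> K (a * b)) -> R `<=` K.
  by case: sR.
move=> Rx f0; apply: contrapT => H0.
have H a b y1 x1 : R a -> inR x1 -> form_trace a b y1 x1 = 0.
  move=> Ra Rx1; apply: contrapT => /eqP h; apply: H0; by exists a, b, y1, x1.
case/eqP: (f0).
have tr0 g al be : R al -> multmap g ->
    \sum_i symf y (upd x i (al * g (x i) * be)) = 0.
  move=> Ral [t ht].
  under eq_bigr => i _.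
    rewrite ht mulr_sumr mulr_suml (multmap_sum _ _ _ (multmap_slot y x i)).
    over.
  rewrite exchange_big big1 //= => c _.
  rewrite -[RHS](H (al * c.1) (c.2 * be) y x (Rr _ _ Ral) Rx).
  by apply: eq_bigr => i _; rewrite !mulrA.
have main al be y' (X : 'I_m.+1 -> V) : R al -> inR X ->
    symf y x * (al * symf y' X * be) = 0.
  move=> Ral RX; set w := al * _ * be.
  have Rw : R w by exact: (Rr _ _ (Rr _ _ Ral)).
  pose L i u := symf y (upd x i (al * u * be)).
  have ML i : multmap (L i) by exact: (multmap_comp al be (multmap_slot y x i)).
  have key : \sum_i symf y (upd x i w) * x i = 0.
    have inner i : L i (symf y' (upd X ord0 (x i))) * X ord0
        + (L i (symf y' X) * x i
           + \sum_(s | s != ord0) L i (symf y' (upd (upd X s (X ord0)) ord0 (x i))) * X s) = 0.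
      have := exchange_inner y' (ML i) (upd_in ord0 RX (Rx i)) (RX ord0).
      rewrite (bigD1 ord0) //= upd_upd upd_id updK => h.
      rewrite -[RHS]h; congr (_ + (_ + _)).
      apply: eq_bigr => s s0; rewrite upd_comm //; congr (_ * _).
      by rewrite /upd (negPf s0).
    have : \sum_i (L i (symf y' (upd X ord0 (x i))) * X ord0
        + (L i (symf y' X) * x i
           + \sum_(s | s != ord0) L i (symf y' (upd (upd X s (X ord0)) ord0 (x i))) * X s)) = 0.
      by rewrite big1.
    rewrite big_split /= -mulr_suml.
    rewrite (tr0 (fun u => symf y' (upd X ord0 u)) al be Ral (multmap_slot _ _ _)).
    rewrite mul0r add0r big_split /= exchange_big /= addrC big1 ?add0r // => s s0.
    rewrite -mulr_suml.
    rewrite (tr0 (fun u => symf y' (upd (upd X s (X ord0)) ord0 u)) al be Ral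
      (multmap_slot _ _ _)).
    by rewrite mul0r.
  have := exchange_left y Rx (g := id) _ Rw; rewrite key addr0; apply.
  by exists [:: (1, 1)] => v; rewrite big_seq1 mul1r mulr1.
have RS := symf_generates Rx f0.
apply: (left_ann0 aG sR); first exact: symf_in.
apply: RR; first by split=> [|c d hc hd]; rewrite /= ?mulr0 // mulrBr hc hd subrr.
move=> a b Ra Rb /=.
suff : forall al, R al -> symf y x * (al * b) = 0 by move/(_ _ Ra).
apply: (RS _ Rb [set b | forall al, R al -> symf y x * (al * b) = 0]).
  split=> [al Ral|c d hc hd al Ral]; first by rewrite !mulr0.
  by rewrite mulrBr mulrBr hc // hd // subrr.
move=> _ [u [v [y' [X [RX ->]]]]] al Ral.
by rewrite -(main (al * u) v y' X) ?mulrA //; exact: Rr.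
Qed.
End Exchange.

(** * The centroid *)

Section Centroid.
Variables (V : nzRingType) (G : set (V -> V)) (R : set V).
Hypotheses (aG : autgroup G) (sR : simple_idempotent G R).

Let Rl := simple_mull sR.
Let Rr := simple_mulr sR.
Let Rg := simple_subgrp sR.
Let RR : forall K, subgrp K -> (forall a b, R a -> R b -> K (a * b)) -> R `<=` K.
Proof. by case: sR. Qed.

Definition centroid (t : V -> V) :=
  [/\ forall r, R r -> R (t r), forall r, ~ R r -> t r = 0,
      forall a b, R a -> R b -> t (a - b) = t a - t b,
      forall u r, R r -> t (u * r) = u * t r &
      forall u r, R r -> t (r * u) = t r * u].

Lemma centroid0 t : centroid t -> t 0 = 0.
Proof.
by move=> [_ _ tB _ _]; rewrite -[in LHS](subrr 0) tB ?subrr //; exact: Rg.1.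
Qed.

Lemma centroid_comp t t' : centroid t -> centroid t' -> centroid (t \o t').
Proof.
move=> ct [tR tN tB tl tr]; have [sR' sN sB sl sr] := ct; split=> /=.
- by move=> r Rx; exact/sR'/tR.
- by move=> r Rx; rewrite tN // (centroid0 ct).
- by move=> a b Ra Rb; rewrite tB // sB //; exact: tR.
- by move=> u r Rx; rewrite tl // sl //; exact: tR.
- by move=> u r Rx; rewrite tr // sr //; exact: tR.
Qed.

Lemma centroid_subgrp t (K : set V) : centroid t -> subgrp K ->
  subgrp [set r | R r /\ K (t r)].
Proof.
move=> ct [K0 KB]; have [tR tN tB _ _] := ct; split=> /=.
  by rewrite (centroid0 ct); split=> //; exact: Rg.1.
by move=> a b [Ra Ka] [Rb Kb]; rewrite tB //; split; [exact: Rg.2 | exact: KB].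
Qed.

Lemma subgrp0 : subgrp [set (0 : V)].
Proof. by split=> //= x y -> ->; rewrite subrr. Qed.

Lemma centroidC t t' r : centroid t -> centroid t' -> t (t' r) = t' (t r).
Proof.
move=> ct ct'; case: (pselect (R r)) => [Rx|nRx]; last first.
  have [_ tN _ _ _] := ct; have [_ tN' _ _ _] := ct'.
  by rewrite (tN' _ nRx) (tN _ nRx) (centroid0 ct) (centroid0 ct').
have [tR _ tB tl tr] := ct; have [tR' _ tB' tl' tr'] := ct'.
suff : R `<=` [set r | R r /\ t (t' r) = t' (t r)] by move=> /(_ _ Rx)[].
apply: RR => /= [|a b Ra Rb].
  split=> [|a b [Ra ha] [Rb hb]].
    by rewrite /= (centroid0 ct') (centroid0 ct) (centroid0 ct'); split=> //; exact: Rg.1.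
  split; first exact: Rg.2.
  rewrite (tB' _ _ Ra Rb) (tB _ _ Ra Rb) (tB _ _ (tR' _ Ra) (tR' _ Rb)).
  by rewrite (tB' _ _ (tR _ Ra) (tR _ Rb)) ha hb.
split; first exact: Rl.
by rewrite (tr' _ _ Ra) (tl _ _ Rb) (tl _ _ Rb) (tr' _ _ Ra).
Qed.

Lemma centroidM t t' a b : centroid t -> centroid t' -> R a -> R b ->
  t a * t' b = t (t' (a * b)).
Proof.
move=> [_ _ _ tl tr] [tR' _ _ tl' _] Ra Rb.
by rewrite tl' // tr.
Qed.

Lemma centroid_ring : exists (K : comNzRingType) (act : K -> V -> V),
  [/\ forall k, centroid (act k),
      forall k k' r, act (k * k') r = act k (act k' r),
      forall t, centroid t -> exists k, act k = t,
      (forall r, act 0 r = 0) &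
      forall k, (forall r, R r -> act k r = 0) -> k = 0].
Proof.
pose T := {t : V -> V | centroid t}.
have Teq (s t : T) : (forall r, R r -> sval s r = sval t r) -> s = t.
  case: s t => [s cs] [t ct] /= st.
  have e : s = t.
    apply/funext => r; case: (pselect (R r)) => [/st //|nR].
    by have [_ -> // _ _ _] := cs; have [_ -> // _ _ _] := ct.
  by subst t; congr exist; exact: Prop_irrelevance.
have czero : centroid (fun=> 0).
  by split=> [r _|r _|a b _ _|u r _|u r _]; rewrite ?subrr ?mulr0 ?mul0r //; exact: Rg.1.
have cadd s t : centroid s -> centroid t -> centroid (fun r => s r + t r).
  move=> [sR1 sN sB sl sr] [tR tN tB tl tr]; split=> /=.
  - by move=> r Rx; apply: subgrpD; [exact: Rg | exact: sR1 | exact: tR].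
  - by move=> r Rx; rewrite sN // tN // addr0.
  - by move=> a b Ra Rb; rewrite sB // tB // addrACA -opprD.
  - by move=> u r Rx; rewrite sl // tl // mulrDr.
  - by move=> u r Rx; rewrite sr // tr // mulrDl.
have copp s : centroid s -> centroid (fun r => - s r).
  move=> [sR1 sN sB sl sr]; split=> /=.
  - by move=> r Rx; apply: subgrpN; [exact: Rg | exact: sR1].
  - by move=> r Rx; rewrite sN // oppr0.
  - by move=> a b Ra Rb; rewrite sB // opprD.
  - by move=> u r Rx; rewrite sl // mulrN.
  - by move=> u r Rx; rewrite sr // mulNr.
have cone : centroid (fun r => if `[< R r >] then r else 0).
  split=> [r Rx|r /asboolPn/negbTE -> //|a b Ra Rb|u r Rx|u r Rx].
  - by rewrite asboolT.
  - by rewrite !asboolT //; exact: Rg.2.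
  - by rewrite !asboolT //; exact: Rl.
  - by rewrite !asboolT //; exact: Rr.
pose zero : T := exist _ _ czero.
pose one : T := exist _ _ cone.
pose add (s t : T) : T := exist _ _ (cadd _ _ (svalP s) (svalP t)).
pose opp (s : T) : T := exist _ _ (copp _ (svalP s)).
pose mul (s t : T) : T := exist _ _ (centroid_comp (svalP s) (svalP t)).
have addA : associative add by move=> r s t; apply: Teq => x _ /=; rewrite addrA.
have addC : commutative add by move=> s t; apply: Teq => x _ /=; rewrite addrC.
have add0 : left_id zero add by move=> s; apply: Teq => x _ /=; rewrite add0r.
have addN : left_inverse zero opp add by move=> s; apply: Teq => x _ /=; rewrite addNr.
have mulA : associative mul by move=> r s t; apply: Teq.
have mulC : commutative mul.
  by move=> s t; apply: Teq => x _ /=; rewrite (centroidC _ (svalP s) (svalP t)).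
have mul1 : left_id one mul.
  move=> s; apply: Teq => x Rx /=; rewrite asboolT //.
  by have [sR1 _ _ _ _] := svalP s; exact: sR1.
have mulD : left_distributive mul add by move=> r s t; apply: Teq => x _.
have one0 : one <> zero.
  have [_ _ [r [Rx r0]] _ _] := sR => /(congr1 (fun s => sval s r)) /=.
  by rewrite asboolT //; exact/eqP.
pose E := gen_eqMixin T; pose C := gen_choiceMixin T.
pose TC : choiceType := HB.pack T E C.
have one0' : (one : TC) != zero by apply/eqP.
pose Zm := GRing.isZmodule.Build TC addA addC add0 addN.
pose TZ : zmodType := HB.pack TC Zm.
pose Rm := GRing.Zmodule_isComNzRing.Build TZ mulA mulC mul1 mulD one0'.
pose K : comNzRingType := HB.pack TZ Rm.
exists K, (fun k : K => sval (k : T)); split=> //.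
- by move=> k; exact: (svalP (k : T)).
- by move=> t ct; exists (exist _ t ct).
- by move=> k hk; apply: Teq => r Rx; exact: hk.
Qed.

End Centroid.

(** * Contradiction for nil rings without invariant ideals *)

Section NilSimple.
Variables (V : nzRingType) (G : set (V -> V)) (R : set V).
Hypotheses (aG : autgroup G) (sR : simple_idempotent G R).
Variable Q : nat.
Hypotheses (nilR : forall x, R x -> x ^+ Q = 0) (oR : oligomorphic G R).

Let Rl := simple_mull sR.
Let Rr := simple_mulr sR.
Let Rg := simple_subgrp sR.
Let RR : forall K, subgrp K -> (forall a b, R a -> R b -> K (a * b)) -> R `<=` K.
Proof. by case: sR. Qed.
Let iR : invariant G R. Proof. by case: sR. Qed.

Lemma trace_centroid : exists (s : V -> V) (a : V),
  [/\ centroid R s, R a, exists r, R r /\ s r != 0 &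
      forall r, R r -> addspan [set z | exists u v, z = u * a * v] (s r)].
Proof.
have [m [[y0 [x0 [Rx0 f0]]] van]] := maximal_form aG sR nilR oR.
have [a [b [y1 [x1 [Ra Rx1 d1]]]]] := trace_nondegenerate aG sR van Rx0 f0.
pose inR (x : 'I_m.+1 -> V) := forall i, R (x i).
have RS := symf_generates aG sR Rx0 f0.
have form_trace_in y x : inR x -> R (form_trace a b y x).
  move=> Rx; apply: subgrp_sum => // i _; apply: (symf_in sR) => j.
  by apply: upd_in => //; apply: Rr; exact: Rl.
pose P r r' := R r' /\ forall u y (x : 'I_m.+1 -> V), inR x ->
  r' * u * symf y x = r * u * form_trace a b y x.
have Pu r r' r'' : P r r' -> P r r'' -> r' = r''.
  move=> [R1 h1] [R2 h2]; apply/eqP; rewrite -subr_eq0; apply/eqP.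
  apply: (left_ann0 aG sR) => [|z Rz]; first exact: Rg.2.
  apply: (RS _ Rz [set z | (r' - r'') * z = 0]).
    by split=> [|c d hc hd]; rewrite /= ?mulr0 // mulrBr hc hd subrr.
  move=> _ [u [v [y [x [Rx ->]]]]] /=.
  by rewrite !mulrA mulrBl mulrBl h1 // h2 // subrr mul0r.
have PB r1 r1' r2 r2' : P r1 r1' -> P r2 r2' -> P (r1 - r2) (r1' - r2').
  move=> [R1 h1] [R2 h2]; split=> [|u y x Rx]; first exact: Rg.2.
  by rewrite !mulrBl h1 // h2.
have Pl r r' u : P r r' -> P (u * r) (u * r').
  move=> [R1 h1]; split=> [|w y x Rx]; first exact: Rl.
  by rewrite -!mulrA mulrA -[u * _]/(u * _) -(mulrA u) (mulrA r') h1 // !mulrA.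
have Pr r r' u : P r r' -> P (r * u) (r' * u).
  move=> [R1 h1]; split=> [|w y x Rx]; first exact: Rr.
  by rewrite -(mulrA r') -(mulrA r) h1.
have Pf y x : inR x -> P (symf y x) (form_trace a b y x).
  by move=> Rx; split=> [|w y' x' Rx']; [exact: form_trace_in | rewrite (form_traceC sR van)].
have Pex r : R r -> exists r', P r r'.
  move=> Rz; apply: (RS _ Rz [set z | exists r', P z r']).
    split=> [|c d [c' hc] [d' hd]]; last by exists (c' - d'); exact: PB.
    exists 0; split=> [|u y x _]; first exact: Rg.1.
    by rewrite !mul0r.
  move=> _ [u [v [y [x [Rx ->]]]]]; exists (u * form_trace a b y x * v).
  by apply: Pr; apply: Pl; exact: Pf.
have [|s hs] := @choice V V (fun r r' => (R r -> P r r') /\ (~ R r -> r' = 0)).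
  move=> r; case: (pselect (R r)) => [/[dup] Rz /Pex[r' h]|nR]; first by exists r'.
  by exists 0.
have sP r : R r -> P r (s r) by move=> Rz; exact: (hs r).1.
exists s, a; split=> //.
- split.
  + by move=> r /sP[].
  + by move=> r nR; exact: (hs r).2.
  + by move=> c d Rc Rd; apply: (Pu (c - d)); [apply: sP; exact: Rg.2 | by apply: PB; exact: sP].
  + by move=> u r Rz; apply: (Pu (u * r)); [apply: sP; exact: Rl | by apply: Pl; exact: sP].
  + by move=> u r Rz; apply: (Pu (r * u)); [apply: sP; exact: Rr | by apply: Pr; exact: sP].
- have Rf : R (symf y1 x1) by exact: (symf_in sR).
  exists (symf y1 x1); split=> //.
  by rewrite (Pu _ _ _ (sP _ Rf) (Pf _ _ Rx1)).
- move=> r Rz.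
  suff [r' [hr' Prr']] : exists r', addspan [set z | exists u v, z = u * a * v] r' /\ P r r'.
    by rewrite (Pu _ _ _ (sP _ Rz) Prr').
  apply: (RS _ Rz [set z | exists r', addspan [set z | exists u v, z = u * a * v] r' /\ P z r']).
    split=> [|c d [c' [ac hc]] [d' [ad hd]]].
      exists 0; split; first exact: (addspan_subgrp _).1.
      by split=> [|u y x _]; [exact: Rg.1 | rewrite !mul0r].
    by exists (c' - d'); split; [exact: (addspan_subgrp _).2 | exact: PB].
  move=> _ [u [v [y [x [Rx ->]]]]]; exists (u * form_trace a b y x * v); split; last first.
    by apply: Pr; apply: Pl; exact: Pf.
  have [_ al ar] : ideal2 (addspan [set z | exists u v, z = u * a * v]).
    apply: addspan_ideal => w _ [u' [v' ->]].
      by exists (w * u'), v'; rewrite !mulrA.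
    by exists u', (v' * w); rewrite !mulrA.
  apply: ar; apply: al; apply: subgrp_sum => [|i _]; first exact: addspan_subgrp.
  have [t ->] := symf_slot y x i; apply: subgrp_sum => [|c _]; first exact: addspan_subgrp.
  by apply: addspan_sub; exists c.1, (x i * b * c.2); rewrite !mulrA.
Qed.

Lemma centroid_iter s k : centroid R s -> centroid R (iter k.+1 s).
Proof.
move=> cs; elim: k => [|k IH] //.
exact: (centroid_comp sR cs IH).
Qed.

Lemma square_zero_centroid : exists t,
  [/\ centroid R t, exists r, R r /\ t r != 0 & forall r, t (t r) = 0].
Proof.
have [s [a [cs Ra [r0 [Rr0 sr0]] sa]]] := trace_centroid.
have [C hC] := uniform_kills aG sR nilR oR.
have killed k r : (k <= C)%N -> R r -> kills (C - k) a (iter k s r).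
  elim: k r => [|k IH] r kC Rz.
    by rewrite subn0 -(mulr1 r); apply: kills_mull; exact: hC.
  suff : [set r | R r /\ kills (C - k.+1) a (iter k.+1 s r)] r by case.
  apply: RR Rz; first exact: (centroid_subgrp sR (centroid_iter k cs) (kills_subgrp _ _)).
  move=> c d Rc Rd; split; first exact: Rr.
  have -> : iter k.+1 s (c * d) = iter k s c * s d.
    have [_ _ _ sl sr] := cs.
    case: k {IH kC} => [|k]; first by rewrite /= sl.
    have [tR _ _ _ tr] := centroid_iter k cs.
    by rewrite iterS tr // sl.
  have kc := IH c (ltnW kC) Rc.
  have e : (C - k = (C - k.+1).+1)%N by rewrite subnSK.
  rewrite e in kc.
  apply: (sa _ Rd [set z | kills (C - k.+1) a (iter k s c * z)]).
    split=> [|z1 z2 h1 h2] /=; first by rewrite mulr0; exact: (kills_subgrp _ _).1.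
    by rewrite mulrBr; apply: (kills_subgrp _ _).2.
  by move=> _ [u [v ->]] /=; rewrite !mulrA; apply: kills_mulr; exact: kc.
pose Z k := `[< forall r, R r -> iter k s r = 0 >].
have ZC : exists k, Z k.
  by exists C; apply/asboolP => r Rz; have := killed C r (leqnn _) Rz; rewrite subnn.
have [j /asboolP Zj jmin] := ex_minnP ZC.
have j1 : (1 < j)%N.
  case: j Zj jmin => [|[|j]] // Zj _.
    by case/eqP: sr0; rewrite -[r0]/(iter 0 s r0) Zj // (centroid0 sR cs).
  by case/eqP: sr0; exact: Zj.
case: j j1 Zj jmin => [|[|j]] // _ Zj jmin.
have ct := centroid_iter j cs.
exists (iter j.+1 s); split=> //.
  apply: contrapT => /forallNP h; suff : (j.+2 <= j.+1)%N by rewrite ltnn.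
  apply: jmin; apply/asboolP => r Rz; apply: contrapT => /eqP hr.
  by apply: (h r).
move=> r; have [tR tN _ _ _] := ct; case: (pselect (R r)) => [Rz|/tN ->]; last first.
  exact: (centroid0 sR ct).
rewrite -iterD addSnnS iterD Zj //.
by case: j {Zj jmin ct tR tN} => // j; exact: (centroid0 sR (centroid_iter j cs)).
Qed.

(* The length of the shortest zigzag of [b] along [X] and [Y] is an invariant of
   the triple [(X, Y, b)]. *)
Fixpoint zigzag n (X Y b : V) : Prop :=
  if n is n'.+1 then exists u, [/\ R u, b = X * u & zigzag n' X Y (Y * u)] else b = 0.

Lemma zigzagS n X Y b : zigzag n X Y b -> zigzag n.+1 X Y b.
Proof.
elim: n b => [|n IH] b; first by move=> /= ->; exists 0; rewrite !mulr0; split=> //; exact: Rg.1.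
by move=> [u [Ru -> h]]; exists u; split=> //; exact: IH.
Qed.

Lemma zigzag_aut g n X Y b : G g -> zigzag n X Y b -> zigzag n (g X) (g Y) (g b).
Proof.
move=> Gg; have [_ gM _] := aG Gg; have [g0 _ _ _] := aut_facts aG Gg.
elim: n b => [|n IH] b /=; first by move=> ->.
by move=> [u [Ru -> /IH h]]; exists (g u); split; [exact: iR | exact: gM | rewrite -gM].
Qed.

Lemma zigzag_bound : exists n, forall X Y b, R X -> R Y -> R b ->
  forall k, zigzag k X Y b -> zigzag n X Y b.
Proof.
have [n hn] : exists n, forall X Y b, R X -> R Y -> R b ->
    (exists k, zigzag k X Y b) -> zigzag n X Y b.
  apply: oR.
  - by move=> n X Y b h /h; exact: zigzagS.
  - move=> g n X Y b Gg h [k hk]; apply: zigzag_aut => //; apply: h; exists k.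
    have [_ _ [f [Gf gf fg]]] := aG Gg.
    by rewrite -(gf X) -(gf Y) -(gf b); exact: zigzag_aut.
  - move=> X Y b _ _ _; case: (pselect (exists k, zigzag k X Y b)) => [[k hk]|h].
      by exists k.
    by exists 0%N.
by exists n => X Y b RX RY Rb k hk; apply: hn => //; exists k.
Qed.

Lemma nil_simple_False : False.
Proof.
have [K [act [actC actM act_ex act0 act_eq0]]] := centroid_ring sR.
have hK (T : K) : T != 0 -> exists t, t * t = 0 /\ T * t != 0.
  have [s [cs [r0 [Rr0 sr0]] ss]] := square_zero_centroid.
  pose S := [set z | exists t r, [/\ centroid R t, forall r, t (t r) = 0, R r & z = t r]].
  have RS : R `<=` addspan S.
    apply: (addspan_generates aG sR).
    - move=> u _ [t [r [ct tt Rz ->]]]; exists t, (u * r); split=> //; first exact: Rl.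
      by have [_ _ _ -> ] := ct.
    - move=> u _ [t [r [ct tt Rz ->]]]; exists t, (r * u); split=> //; first exact: Rr.
      by have [_ _ _ _ ->] := ct.
    - move=> g _ Gg [t [r [ct tt Rz ->]]].
      have [gB gM [h [Gh gh hg]]] := aG Gg; have [hB hM _] := aG Gh.
      have [g0 _ _ _] := aut_facts aG Gg.
      have [tR tN tB tl tr] := ct.
      exists (g \o t \o h), (g r); split=> /=; [| | exact: iR | by rewrite gh].
      + split=> /=.
        * by move=> z Rz'; apply: iR => //; apply: tR; exact: iR.
        * move=> z nR; rewrite tN ?g0 // => Rhz; apply: nR; rewrite -(hg z); exact: iR.
        * by move=> c d Rc Rd; rewrite hB tB ?gB //; exact: iR.
        * by move=> u z Rz'; rewrite hM tl ?gM ?hg //; exact: iR.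
        * by move=> u z Rz'; rewrite hM tr ?gM ?hg //; exact: iR.
      + by move=> z; rewrite gh tt g0.
    - by move=> _ [t [r [[tR _ _ _ _] _ Rz ->]]]; exact: tR.
    - by exists (s r0); split=> //; exists s, r0.
  move=> T0; apply: contrapT => /forallNP hT; case/eqP: T0; apply: (act_eq0 T) => r Rz.
  have cT := actC T.
  suff : [set r | R r /\ act T r = 0] r by case.
  apply: (RS _ Rz); first exact: (centroid_subgrp sR cT (subgrp0 V)).
  move=> _ [t [z [ct tt Rz' ->]]]; split; first by have [tR _ _ _ _] := ct; exact: tR.
  have [k kt] := act_ex _ ct; rewrite -kt -actM.
  suff -> : T * k = 0 by exact: act0.
  apply: contrapT => /eqP h; apply: (hT k); split=> //.
  by apply: act_eq0 => r' _; rewrite actM kt.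
have [n hn] := zigzag_bound.
have [x [y [e [v [e0 eS vS top]]]]] := square_zero_chain n hK.
have actR k r : R r -> R (act k r) by have [tR _ _ _ _] := actC k; exact: tR.
have actP k k' a b : R a -> R b -> act k a * act k' b = act (k * k') (a * b).
  by move=> Ra Rb; rewrite actM (centroidM (actC k) (actC k')).
case/eqP: top; apply: (act_eq0 _).
set w := x * e 0%N * v 0%N; have cw := actC w.
suff H3 a b c : R a -> R b -> R c -> act w (a * (b * c)) = 0.
  move=> r Rz; suff : [set r | R r /\ act w r = 0] r by case.
  apply: RR Rz; first exact: (centroid_subgrp sR cw (subgrp0 V)).
  move=> a b Ra Rb; split; first exact: Rl.
  have [_ _ _ wl _] := cw; rewrite wl //.
  suff : [set r | R r /\ [set z | a * z = 0] (act w r)] b by case.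
  apply: RR Rb; first apply: (centroid_subgrp sR cw).
    by split=> [|c d hc hd]; rewrite /= ?mulr0 // mulrBr hc hd subrr.
  move=> c d Rc Rd; split; first exact: Rl.
  by rewrite /= -wl; [exact: H3 | exact: Rl].
move=> Ra Rb Rc.
pose X := act x b; pose Y := act y b; pose U r := act (e r) c; pose D j := act (v j) a.
have YU0 : Y * U 0%N = 0 by rewrite actP // e0 act0.
have YUS r : Y * U r.+1 = X * U r by rewrite !actP // eS.
have DXY j : (j < n)%N -> D j.+1 * X = D j * Y.
  by move=> jn; rewrite !actP // mulrC vS // mulrC.
have zz r : zigzag r.+1 X Y (X * U r).
  elim: r => [|r IH]; first by exists (U 0%N); split=> //; exact: actR.
  by exists (U r.+1); split=> //; [exact: actR | rewrite YUS].
have RX : R X by exact: actR.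
have zn : zigzag n X Y (X * U n).
  by apply: (hn _ _ _ _ _ _ n.+1) => //; [exact: actR | exact: Rr].
have kill k b' : (k <= n)%N -> zigzag k X Y b' -> D k * b' = 0.
  elim: k b' => [|k IH] b' kn; first by move=> /= ->; rewrite mulr0.
  by move=> [u [Ru -> /(IH _ (ltnW kn)) h]]; rewrite mulrA DXY // -mulrA.
have := kill n _ (leqnn n) zn.
have -> : D n * (X * U n) = D 0%N * (X * U 0%N).
  have : (n <= n)%N by []. 
  elim: {1 3 4}n => // k IH kn.
  by rewrite -IH 1?ltnW // mulrA DXY // -mulrA YUS.
rewrite actP // actP //; last exact: Rl.
by rewrite /w mulrC.
Qed.

End NilSimple.

(** * Nil rings with oligomorphic automorphism group *)

Lemma quotient_ring (U : nzRingType) (J : set U) : ideal2 J -> ~ J 1 ->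
  exists (V : nzRingType) (f : U -> V),
    [/\ {morph f : x y / x - y}, {morph f : x y / x * y},
        forall v, exists u, f u = v & forall u, f u = 0 <-> J u].
Proof.
move=> [[J0 JB] Jl Jr] J1.
pose P : pred U := fun x => `[< J x >].
have Pz : zmod_closed P.
  split; first exact/asboolP.
  by move=> x y /asboolP Jx /asboolP Jy; apply/asboolP; exact: JB.
pose Pm := GRing.isZmodClosed.Build U P Pz.
pose I : zmodClosed U := HB.pack P Pm.
pose T : zmodType := Quotient.quot I.
pose f (x : U) : T := \pi_(Quotient.quot I)%qT x.
have fE x y : f x = f y <-> J (x - y).
  have h := Quotient.idealrBE I x y; split.
    by move=> e; apply/asboolP; rewrite -[asbool _]/(x - y \in I) h; apply/eqP.
  by move=> /asboolP Jxy; apply/eqP; rewrite -h.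
have fS v : exists u, f u = v by exists (repr v); exact: reprK.
have fB : {morph f : x y / x - y} by move=> x y; rewrite /f !piE.
have fD : {morph f : x y / x + y} by move=> x y; rewrite /f !piE.
pose mul (a b : T) : T := f (repr a * repr b).
have fr v : f (repr v) = v by exact: reprK.
have fM : {morph f : x y / x * y >-> mul x y}.
  move=> x y; apply/fE.
  have /fE h1 : f x = f (repr (f x)) by rewrite fr.
  have /fE h2 : f y = f (repr (f y)) by rewrite fr.
  have -> : x * y - repr (f x) * repr (f y)
     = (x - repr (f x)) * y + repr (f x) * (y - repr (f y)).
    by rewrite mulrBl mulrBr addrA subrK.
  by apply: (@subgrpD _ J); [split | exact: Jr | exact: Jl].
have mulA : associative mul.
  move=> a b c; have [x <-] := fS a; have [y <-] := fS b; have [z <-] := fS c.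
  by rewrite -!fM mulrA.
have mul1 : left_id (f 1) mul by move=> a; have [x <-] := fS a; rewrite -fM mul1r.
have mulx1 : right_id (f 1) mul by move=> a; have [x <-] := fS a; rewrite -fM mulr1.
have mulDl : left_distributive mul +%R.
  move=> a b c; have [x <-] := fS a; have [y <-] := fS b; have [z <-] := fS c.
  by rewrite -fD -!fM -fD mulrDl.
have mulDr : right_distributive mul +%R.
  move=> a b c; have [x <-] := fS a; have [y <-] := fS b; have [z <-] := fS c.
  by rewrite -fD -!fM -fD mulrDr.
have f0 : f 0 = 0 by rewrite -[in LHS](subrr 0) fB subrr.
have one0 : f 1 != 0 by apply/eqP; rewrite -f0 => /fE; rewrite subr0.
pose Rm := GRing.Zmodule_isNzRing.Build T mulA mul1 mulx1 mulDl mulDr one0.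
pose V : nzRingType := HB.pack T Rm.
exists V, f; split=> // u; rewrite -f0; split=> [/fE|Ju]; first by rewrite subr0.
by apply/fE; rewrite subr0.
Qed.

Section Powers.
Variables (U : nzRingType) (G : set (U -> U)) (N : set U).

(* [ideal_pow k] is the power [N ^ (k + 1)]. *)
Fixpoint ideal_pow (k : nat) : set U :=
  if k is k'.+1 then addspan [set z | exists x y, [/\ ideal_pow k' x, N y & z = x * y]]
  else N.

Hypotheses (aG : autgroup G) (idN : ideal2 N) (iN : invariant G N).

Lemma ideal_pow_ideal k : ideal2 (ideal_pow k).
Proof.
elim: k => [//|k [_ IHl IHr]] /=; have [_ Nl Nr] := idN.
apply: addspan_ideal => u _ [x [y [hx hy ->]]].
  by exists (u * x), y; rewrite mulrA; split=> //; exact: IHl.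
by exists x, (y * u); rewrite mulrA; split=> //; exact: Nr.
Qed.

Lemma ideal_pow_inv k : invariant G (ideal_pow k).
Proof.
elim: k => [//|k IH] /= g z Gg; have [gB gM _] := aG Gg.
apply: (addspan_map gB) => _ [x [y [hx hy ->]]]; apply: addspan_sub.
by exists (g x), (g y); rewrite gM; split=> //; [exact: IH | exact: iN].
Qed.

Lemma ideal_powS k : ideal_pow k.+1 `<=` ideal_pow k.
Proof.
have [sk _ kr] := ideal_pow_ideal k.
by apply: addspan_le => // _ [x [y [hx hy ->]]]; exact: kr.
Qed.

Lemma ideal_pow_le j k : (j <= k)%N -> ideal_pow k `<=` ideal_pow j.
Proof.
move=> /subnKC <-; elim: (k - j)%N => [|d IH]; first by rewrite addn0.
by rewrite addnS => x /ideal_powS/IH.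
Qed.

Lemma ideal_powD j k : ideal_pow (j + k.+1) `<=`
  addspan [set z | exists x y, [/\ ideal_pow j x, ideal_pow k y & z = x * y]].
Proof.
elim: k => [|k IH]; first by rewrite addn1.
rewrite addnS; apply: addspan_le; first exact: addspan_subgrp.
move=> _ [x [y [/IH hx hy ->]]].
apply: (addspan_map (g := *%R^~ y) _ _ hx) => [a b|_ [a [b [ha hb ->]]]] /=.
  by rewrite mulrBl.
apply: addspan_sub; exists a, (b * y); rewrite mulrA; split=> //.
by apply: addspan_sub; exists b, y.
Qed.

End Powers.

Section NilNilpotent.
Variables (U : nzRingType) (G : set (U -> U)) (N : set U) (Q : nat).
Hypotheses (aG : autgroup G) (idN : ideal2 N) (iN : invariant G N).
Hypotheses (oN : oligomorphic G N) (nilN : forall x, N x -> x ^+ Q = 0).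

Let inv2 (K : set U) g a : invariant G K -> G g -> K (g a) -> K a.
Proof.
by move=> iK Gg; have [_ _ [h [Gh gh _]]] := aG Gg => /(iK _ _ Gh); rewrite gh.
Qed.

Lemma ideal_pow_stable : exists n, forall a k, ideal_pow N n a -> ideal_pow N (n + k) a.
Proof.
have [n hn] : exists n, forall a, N a ->
    ideal_pow N n a -> forall k, ideal_pow N (n + k) a.
  apply: (oligomorphic1 oN).
  - move=> n a h ha k; rewrite addSnnS; apply: h.
    exact: (ideal_powS idN).
  - move=> g n a Gg h ha k; apply: (ideal_pow_inv aG iN) => //; apply: h.
    exact: (inv2 (ideal_pow_inv aG iN (k := n)) Gg).
  - move=> a _; case: (pselect (forall n, ideal_pow N n a)) => [h|/existsNP[n h]].
      by exists 0%N => _ k; exact: h.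
    by exists n.
exists n => a k ha; apply: hn => //.
exact: (ideal_pow_le idN (leq0n n)).
Qed.

Lemma maximal_invariant_ideal (I : set U) : I 0 -> I `<=` N -> (exists x, I x /\ x != 0) ->
  exists J, [/\ ideal2 J, invariant G J, J `<=` I, ~ I `<=` J &
    forall K, ideal2 K -> invariant G K -> K `<=` I -> J `<=` K -> ~ K `<=` J -> I `<=` K].
Proof.
move=> I0 IN [x0 [Ix0 x00]].
pose P K := [/\ ideal2 K, invariant G K, K `<=` I & ~ I `<=` K].
apply: contrapT => /forallNP H.
have step J : exists K, P J -> [/\ P K, J `<=` K & ~ K `<=` J].
  case: (pselect (P J)) => [[J1 J2 J3 J4]|nP]; last by exists J.
  apply: contrapT => /forallNP h; apply: (H J); split=> // K K1 K2 K3 JK nKJ.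
  by apply: contrapT => IK; apply: (h K).
have [F hF] := choice step.
pose S n := iter n F [set 0].
have PS n : P (S n).
  elim: n => [|n IH]; last by have [] := hF _ IH.
  split=> /=.
  - split; first exact: subgrp0.
      by move=> u x -> /=; rewrite mulr0.
    by move=> u x -> /=; rewrite mul0r.
  - by move=> g x Gg /= ->; have [] := aut_facts aG Gg.
  - by move=> _ /= ->.
  - by move=> /(_ _ Ix0) /eqP; rewrite (negbTE x00).
have SS n : S n `<=` S n.+1 by have [] := hF _ (PS n).
have Sle n k : (n <= k)%N -> S n `<=` S k.
  move=> /subnKC <-; elim: (k - n)%N => [|d IH]; first by rewrite addn0.
  by rewrite addnS => x /IH; exact: SS.
have [n hn] : exists n, forall a, N a -> (exists k, S k a) -> S n a.
  apply: (oligomorphic1 oN).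
  - by move=> n a h /h; exact: SS.
  - move=> g n a Gg h [k hk]; have [_ iS _ _] := PS n; apply: iS => //.
    by apply: h; exists k; have [_ iSk _ _] := PS k; exact: (inv2 iSk Gg).
  - move=> a _; case: (pselect (exists k, S k a)) => [[k hk]|h]; last by exists 0%N.
    by exists k.
have [_ _] := hF _ (PS n); apply=> a Sa; apply: hn; last by exists n.+1.
by have [_ _ SI _] := PS n.+1; exact/IN/SI.
Qed.

Lemma nil_nilpotent : exists c, forall x, ideal_pow N c x -> x = 0.
Proof.
have [n hn] := ideal_pow_stable.
exists n => x Ix; apply: contrapT => /eqP x0.
set I := ideal_pow N n in Ix.
have idI : ideal2 I := ideal_pow_ideal idN n.
have iI : invariant G I := ideal_pow_inv aG iN (k := n).
have IN : I `<=` N := ideal_pow_le idN (leq0n n).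
have [sI Il Ir] := idI.
have II : I `<=` addspan [set z | exists x y, [/\ I x, I y & z = x * y]].
  by move=> a /(hn _ n.+1); exact: ideal_powD.
have [J [idJ iJ JI nIJ maxJ]] :
    exists J, [/\ ideal2 J, invariant G J, J `<=` I, ~ I `<=` J &
    forall K, ideal2 K -> invariant G K -> K `<=` I -> J `<=` K -> ~ K `<=` J -> I `<=` K].
  by apply: maximal_invariant_ideal => //; [exact: sI.1 | exists x].
have J1 : ~ J 1.
  by move=> /JI/IN/nilN/eqP; rewrite expr1n (negbTE (oner_neq0 _)).
have [V [f [fB fM fS f0E]]] := quotient_ring idJ J1.
have f0 : f 0 = 0 by rewrite -[in LHS](subrr 0) fB subrr.
have fE a b : f a = f b <-> J (a - b).
  rewrite -f0E fB; split=> [->|/eqP]; first exact: subrr.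
  by rewrite subr_eq0 => /eqP.
pose G' := [set g' : V -> V | exists g, G g /\ forall u, g' (f u) = f (g u)].
have lift g : G g -> exists g', forall u, g' (f u) = f (g u).
  move=> Gg; have [r hr] := choice fS; exists (fun v => f (g (r v))) => u.
  have [gB _ _] := aG Gg; apply/fE; rewrite -gB; apply: iJ => //.
  by apply/fE; exact: hr.
have aG' : autgroup G'.
  move=> g' [g [Gg hg]]; have [gB gM [h [Gh gh hg']]] := aG Gg.
  have [h' hh'] := lift _ Gh; split.
  - by move=> a b; have [u <-] := fS a; have [v <-] := fS b; rewrite -fB !hg gB fB.
  - by move=> a b; have [u <-] := fS a; have [v <-] := fS b; rewrite -fM !hg gM fM.
  - exists h'; split; first by exists h.
      by move=> a; have [u <-] := fS a; rewrite hg hh' gh.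
    by move=> a; have [u <-] := fS a; rewrite hh' hg hg'.
pose R := f @` I.
have sR : simple_idempotent G' R.
  split.
  - split; first split.
    + by exists 0; [exact: sI.1 | exact: f0].
    + by move=> _ _ [a Ia <-] [b Ib <-]; exists (a - b); [exact: sI.2 | exact: fB].
    + by move=> v _ [a Ia <-]; have [u <-] := fS v; exists (u * a); [exact: Il | exact: fM].
    + by move=> v _ [a Ia <-]; have [u <-] := fS v; exists (a * u); [exact: Ir | exact: fM].
  - by move=> g' _ [g [Gg hg]] [a Ia <-]; exists (g a); [exact: iI | rewrite hg].
  - have /existsNP[a /not_implyP[Ia nJa]] := nIJ.
    by exists (f a); split; [exists a | apply/eqP => /f0E].
  - move=> K sK KM _ [a Ia <-]; apply: (II _ Ia [set u | K (f u)]).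
      by split=> [|b c Kb Kc] /=; rewrite ?f0 ?fB; [exact: sK.1 | exact: sK.2].
    by move=> _ [b [c [Ib Ic ->]]]; rewrite /= fM; apply: KM; [exists b | exists c].
  - move=> K [sK Kl Kr] iK KR [k [Kk k0]].
    pose K0 := [set u | I u /\ K (f u)].
    have IK0 : I `<=` K0.
      apply: maxJ.
      + split; first split.
        * by split; [exact: sI.1 | rewrite f0; exact: sK.1].
        * by move=> a b [Ia Ka] [Ib Kb]; split; [exact: sI.2 | rewrite fB; exact: sK.2].
        * by move=> u a [Ia Ka]; split; [exact: Il | rewrite fM; exact: Kl].
        * by move=> u a [Ia Ka]; split; [exact: Ir | rewrite fM; exact: Kr].
      + move=> g a Gg [Ia Ka]; split; first exact: iI.
        by have [g' hg'] := lift _ Gg; rewrite -hg'; apply: iK => //; exists g.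
      + by move=> a [].
      + by move=> a Ja; split; [exact: JI | have /f0E -> := Ja; exact: sK.1].
      + have [a Ia fa] := KR _ Kk; move=> /(_ a) h; case/eqP: k0; rewrite -fa.
        by apply/f0E; apply: h; split=> //; rewrite fa.
    by move=> _ [a /IK0[_ Ka] <-].
apply: (@nil_simple_False _ _ _ aG' sR Q.+1).
- have fX k a : f a ^+ k.+1 = f (a ^+ k.+1).
    by elim: k => [|k IH]; rewrite ?expr1 // exprS IH -fM -exprS.
  by move=> _ [a Ia <-]; rewrite fX exprS nilN ?mulr0 //; exact: IN.
- move=> X mX iX cX.
  have [k hk] : exists k, forall a b c, N a -> N b -> N c ->
      I a -> I b -> I c -> X k (f a) (f b) (f c).
    apply: oN.
    + by move=> k a b c h Ia Ib Ic; apply: mX; exact: h.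
    + move=> g k a b c Gg h Ia Ib Ic; have [g' hg'] := lift _ Gg.
      rewrite -!hg'; apply: iX; first by exists g.
      by apply: h; exact: (inv2 iI Gg).
    + move=> a b c _ _ _.
      case: (pselect (I a /\ I b /\ I c)) => [[Ia [Ib Ic]]|h].
        have [k hk] := cX (f a) (f b) (f c) (ex_intro2 _ _ a Ia erefl)
          (ex_intro2 _ _ b Ib erefl) (ex_intro2 _ _ c Ic erefl).
        by exists k.
      by exists 0%N => Ia Ib Ic; case: h.
  exists k => _ _ _ [a Ia <-] [b Ib <-] [c Ic <-].
  by apply: hk => //; exact: IN.
Qed.

End NilNilpotent.

(** * Engel rings of prime characteristic *)

Section PrimeCharacteristic.
Variables (U : nzRingType) (p : nat).
Hypothesis charU : p \in [pchar U].

Lemma exprB_pchar_comm (W : nzRingType) (charW : p \in [pchar W]) k (x y : W) :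
  GRing.comm x y -> (x - y) ^+ (p ^ k) = x ^+ (p ^ k) - y ^+ (p ^ k).
Proof.
move=> xy; elim: k => [|k IH]; first by rewrite expn0 !expr1.
rewrite expnSr !exprM IH -!(pFrobenius_autE charW) pFrobenius_autB_comm //.
exact/commrX/commr_sym/commrX/commr_sym.
Qed.

Definition rad (y z : U) := z * y - y * z.

(* Right evaluation at [y] of [('X - y) ^+ m * x] is the [m]-fold bracket of [x]
   with [y], so the Frobenius identity in [{poly U}] applies. *)
Lemma iter_rad_pchar k (x y : U) :
  iter (p ^ k) (rad y) x = x * y ^+ (p ^ k) - y ^+ (p ^ k) * x.
Proof.
have -> m : iter m (rad y) x = ((('X - y%:P) ^+ m * x%:P) : {poly U}).[y].
  elim: m => [|m IH]; first by rewrite expr0 mul1r hornerC.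
  rewrite iterS IH exprS -mulrA mulrBl hornerD hornerN hornerCM.
  by rewrite -(commr_polyX (_ * _)) hornerMX.
rewrite (@exprB_pchar_comm {poly U}) ?pchar_poly //; last exact/commr_sym/commr_polyX.
rewrite -polyC_exp mulrBl hornerD hornerN hornerCM hornerC.
have hX m (q : {poly U}) : (q * 'X^m).[y] = q.[y] * y ^+ m.
  elim: m => [|m IH]; first by rewrite !expr0 !mulr1.
  by rewrite !exprSr !mulrA hornerMX IH.
by rewrite -(commr_polyXn x%:P) hX hornerC.
Qed.

Variables (G : set (U -> U)) (M : set U) (n : nat).
Hypotheses (aG : autgroup G) (idM : ideal2 M) (iM : invariant G M) (oM : oligomorphic G M).
Hypothesis engelM : forall x y, M x -> M y -> iter n (rad y) x = 0.

Let p_gt1 : (1 < p)%N. Proof. exact/prime_gt1/(pcharf_prime charU). Qed.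
Let Mg : subgrp M. Proof. by case: idM. Qed.
Let Ml u x : M x -> M (u * x). Proof. by case: idM => _ h _; exact: h. Qed.
Let Mr u x : M x -> M (x * u). Proof. by case: idM => _ _ h; exact: h. Qed.
Let MX x k : M x -> M (x ^+ k.+1). Proof. by move=> Mx; rewrite exprS; exact: Mr. Qed.
Let MXp x k : M x -> M (x ^+ (p ^ k)).
Proof.
have : (0 < p ^ k)%N by rewrite expn_gt0 ltnW.
by case: (p ^ k)%N => // j _; exact: MX.
Qed.

Lemma engel_central k x y : (n <= k)%N -> M x -> M y ->
  x * y ^+ (p ^ k) = y ^+ (p ^ k) * x.
Proof.
move=> nk Mx My; apply/eqP; rewrite -subr_eq0 -iter_rad_pchar.
have nq : (n <= p ^ k)%N by rewrite (leq_trans nk) // ltnW // ltn_expl.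
rewrite -(subnK nq) iterD engelM //.
by elim: (_ - _)%N => //= m /eqP ->; rewrite /rad mul0r mulr0 subrr.
Qed.

Lemma powers_periodic : exists k, [/\ (n <= k)%N, (0 < k)%N &
  forall a, M a -> a ^+ (p ^ (k + k)) = a ^+ (p ^ k)].
Proof.
have [B hB] : exists B, forall a b c, M a -> M b -> M c ->
    (exists i, b = a ^+ (p ^ i)) -> exists2 i, (i <= B)%N & b = a ^+ (p ^ i).
  apply: oM.
  - by move=> m a b _ h /h[i im ->]; exists i => //; exact: leqW.
  - move=> g m a b _ Gg h [i e].
    have [_ gM [f [_ gf _]]] := aG Gg; have [_ g1 _ _] := aut_facts aG Gg.
    have gX x j : g (x ^+ j) = g x ^+ j.
      by elim: j => [|j IH]; rewrite ?expr0 // !exprS gM IH.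
    have /h[j jm ->] : exists i, b = a ^+ (p ^ i).
      by exists i; apply: (can_inj gf); rewrite gX.
    by exists j.
  - move=> a b _ _ _ _; case: (pselect (exists i, b = a ^+ (p ^ i))) => [[i ->]|h].
      by exists i => _; exists i.
    by exists 0%N.
pose k := ((B.+1)`! * (B + n).+1)%N.
have Bk : ((B + n).+1 <= k)%N by rewrite leq_pmull // fact_gt0.
exists k; split.
- by apply: leq_trans Bk; rewrite leqW // leq_addl.
- exact: leq_trans Bk.
move=> a Ma.
have [i iB e] := hB a _ a Ma (MXp B.+1 Ma) Ma (ex_intro _ B.+1 erefl).
pose d := (B.+1 - i)%N.
have step j : (i <= j)%N -> a ^+ (p ^ (j + d)) = a ^+ (p ^ j).
  move=> ij; have -> : (j + d = B.+1 + (j - i))%N.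
    by rewrite /d addnBA ?(leqW iB) // addnC -addnBA.
  by rewrite expnD exprM e -exprM -expnD subnKC.
have steps t j : (i <= j)%N -> a ^+ (p ^ (j + d * t)) = a ^+ (p ^ j).
  move=> ij; elim: t => [|t IH]; first by rewrite muln0 addn0.
  by rewrite mulnS addnCA addnC step ?IH // (leq_trans ij) ?leq_addr.
have /dvdnP[t kt] : (d %| k)%N.
  by apply: dvdn_mulr; apply: dvdn_fact; rewrite subn_gt0 ltnS iB leq_subr.
rewrite [X in (k + X)%N]kt mulnC steps //.
by apply: leq_trans iB (leq_trans _ Bk); rewrite leqW // leq_addr.
Qed.

Lemma engel_reduction : exists N : set U,
  [/\ ideal2 N, invariant G N, N `<=` M,
      exists Q, forall x, N x -> x ^+ Q = 0 &
      forall x, M x -> exists z, N (x - z) /\ forall y, M y -> z * y = y * z].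
Proof.
have [k [nk k0 per]] := powers_periodic; set Q := (p ^ k)%N.
have Q1 : (1 < Q)%N.
  rewrite /Q -(prednK k0) expnS (leq_trans p_gt1) // leq_pmulr //.
  by rewrite expn_gt0 ltnW.
have perQ a : M a -> (a ^+ Q) ^+ Q = a ^+ Q by move=> Ma; rewrite -exprM -expnD per.
have cQ x y : M x -> M y -> y ^+ Q * x = x * y ^+ Q by move=> Mx My; rewrite (engel_central nk).
pose N := [set x | M x /\ x ^+ Q = 0].
have split_pow s x v : M x -> s = x * v -> s * x = x * s -> forall j, s ^+ j = x ^+ j * v ^+ j.
  move=> Mx e c; elim=> [|j IH]; first by rewrite !expr0 mulr1.
  rewrite exprS IH mulrA.
  have -> : s * x ^+ j = x ^+ j * s by exact: commrX.
  by rewrite e mulrA -exprSr -mulrA -exprS.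
have Nr u x : N x -> N (x * u).
  move=> [Mx x0]; split; first exact: Mr.
  set s := (x * u) ^+ Q.
  have sE : s = x * (u * (x * u) ^+ Q.-1).
    by rewrite mulrA -exprS prednK // ltnW.
  have <- : s ^+ Q = s by exact: (perQ _ (Mr u Mx)).
  rewrite (split_pow s x _ Mx sE) ?x0 ?mul0r //.
  by rewrite cQ //; exact: Mr.
have Nl u x : N x -> N (u * x).
  move=> [Mx x0]; split; first exact: Ml.
  have h : (u * x) ^+ Q.+1 = 0.
    have e j : (u * x) ^+ j.+1 = u * (x * u) ^+ j * x.
      elim: j => [|j IH]; first by rewrite expr1 expr0 mulr1.
      by rewrite exprSr IH exprSr !mulrA.
    by rewrite e (Nr u x _).2 ?mulr0 ?mul0r.
  rewrite -(perQ _ (Ml u Mx)) -exprM.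
  have QQ : (Q.+1 <= Q * Q)%N.
    rewrite -addn1 (leq_trans _ (leq_mul Q1 (leqnn Q))) //.
    by rewrite mul2n -addnn leq_add2l ltnW.
  by rewrite -(subnKC QQ) exprD h mul0r.
exists N; split.
- split=> //; split; first by split; [exact: Mg.1 | rewrite expr0n gtn_eqF // ltnW].
  move=> x y Nx Ny; have [Mx _] := Nx; have [My _] := Ny.
  have Mz : M (x - y) by exact: Mg.2.
  split=> //; set z := x - y in Mz *; set s := z ^+ Q.
  have [Mxw xw0] := Nr (z ^+ Q.-1) x Nx; have [_ yw0] := Nr (z ^+ Q.-1) y Ny.
  have e : y * z ^+ Q.-1 = x * z ^+ Q.-1 - s.
    by rewrite /s -(prednK (ltnW Q1)) exprS /= /z mulrBl opprB addrCA subrr addr0.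
  move: yw0; rewrite e exprB_pchar_comm // ?xw0 ?sub0r; last by rewrite /GRing.comm cQ.
  by rewrite perQ // => /eqP; rewrite oppr_eq0 => /eqP.
- move=> g x Gg [Mx x0]; split; first exact: iM.
  have [_ gM _] := aG Gg; have [g0 g1 _ _] := aut_facts aG Gg.
  have gX j : g (x ^+ j) = g x ^+ j.
    by elim: j => [|j IH]; rewrite ?expr0 // !exprS gM IH.
  by rewrite -gX x0.
- by move=> x [].
- by exists Q => x [].
- move=> x Mx; exists (x ^+ Q); split=> [|y My]; last exact: cQ.
  split; first by apply: Mg.2 => //; exact: MXp.
  rewrite exprB_pchar_comm //; last exact/commrX.
  by rewrite perQ // subrr.
Qed.

End PrimeCharacteristic.

Lemma oligomorphic_sub (U : nzRingType) (G : set (U -> U)) (M N : set U) :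
  autgroup G -> oligomorphic G M -> N `<=` M -> invariant G N -> oligomorphic G N.
Proof.
move=> aG oM NM iN X mX iX cX.
have [n hn] : exists n, forall a b c, M a -> M b -> M c ->
    N a -> N b -> N c -> X n a b c.
  apply: oM.
  - by move=> n a b c h Na Nb Nc; apply: mX; exact: h.
  - move=> g n a b c Gg h Na Nb Nc; apply: iX => //.
    have [_ _ [f [Gf gf _]]] := aG _ Gg.
    by apply: h; [rewrite -(gf a) | rewrite -(gf b) | rewrite -(gf c)]; exact: iN.
  - move=> a b c _ _ _; case: (pselect (N a /\ N b /\ N c)) => [[Na [Nb Nc]]|h].
      by have [n hn] := cX a b c Na Nb Nc; exists n.
    by exists 0%N => Na Nb Nc; case: h.
by exists n => a b c Na Nb Nc; apply: hn => //; exact: NM.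
Qed.

(** * The unital hull and the theorem *)

Definition unital_hull (K : fieldType) (A : assocAlgType K) : Type := (K * A)%type.

Section UnitalHull.
Variables (K : fieldType) (A : assocAlgType K).

HB.instance Definition _ := GRing.Zmodule.on (unital_hull A).

Definition hull_mul (u v : unital_hull A) : unital_hull A :=
  (u.1 * v.1, u.1 *: v.2 + v.1 *: u.2 + amul u.2 v.2).

Lemma amul0 (x : A) : amul x 0 = 0.
Proof. by rewrite -[in LHS](scale0r x) amulZr scale0r. Qed.

Lemma amul0l (x : A) : amul 0 x = 0.
Proof. by rewrite -[in LHS](scale0r x) amulZl scale0r. Qed.

Fact hull_mulA : associative hull_mul.
Proof.
move=> [a x] [b y] [c z]; rewrite /hull_mul /=; congr pair; first exact: mulrA.
rewrite !scalerDr !scalerA !amulDl !amulDr !amulZl !amulZr amulA.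
rewrite (mulrC c a) (mulrC c b).
by rewrite !addrA [LHS](ACl (1*2*4*6*3*5*7)).
Qed.

Fact hull_mul1 : left_id ((1, 0) : unital_hull A) hull_mul.
Proof.
by move=> [a x]; rewrite /hull_mul /= mul1r scale1r scaler0 addr0 amul0l addr0.
Qed.

Fact hull_mulx1 : right_id ((1, 0) : unital_hull A) hull_mul.
Proof.
by move=> [a x]; rewrite /hull_mul /= mulr1 scale1r scaler0 add0r amul0 addr0.
Qed.

Fact hull_mulDl : left_distributive hull_mul +%R.
Proof.
move=> [a x] [b y] [c z]; rewrite /hull_mul /=; congr pair; first exact: mulrDl.
by rewrite /= scalerDl scalerDr amulDl !addrA [LHS](ACl (1*3*5*2*4*6)).
Qed.

Fact hull_mulDr : right_distributive hull_mul +%R.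
Proof.
move=> [a x] [b y] [c z]; rewrite /hull_mul /=; congr pair; first exact: mulrDr.
by rewrite /= scalerDl scalerDr amulDr !addrA [LHS](ACl (1*3*5*2*4*6)).
Qed.

Fact hull_oner_neq0 : ((1, 0) : unital_hull A) != 0.
Proof. by apply/eqP => -[/eqP]; rewrite (negbTE (oner_neq0 _)). Qed.

HB.instance Definition _ := GRing.Zmodule_isNzRing.Build (unital_hull A)
  hull_mulA hull_mul1 hull_mulx1 hull_mulDl hull_mulDr hull_oner_neq0.

Lemma hullM (u v : unital_hull A) : u * v = hull_mul u v. Proof. by []. Qed.

Definition hull_inj (x : A) : unital_hull A := (0, x).

Lemma hull_injM x y : hull_inj (amul x y) = hull_inj x * hull_inj y.
Proof. by rewrite /hull_inj [RHS]/(hull_mul _ _) /hull_mul /= mul0r !scale0r !add0r. Qed.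

Lemma hull_injB x y : hull_inj (x - y) = hull_inj x - hull_inj y.
Proof. by have -> : hull_inj x - hull_inj y = (0 - 0, x - y) by []; rewrite subrr. Qed.

Lemma hull_inj_sum (m : nat) (k : 'I_m -> K) (w : 'I_m -> A) :
  hull_inj (\sum_(j < m) k j *: w j)
    = \sum_(j < m) ((k j, 0) : unital_hull A) * hull_inj (w j).
Proof.
have D x y : hull_inj (x + y) = hull_inj x + hull_inj y.
  by have -> : hull_inj x + hull_inj y = (0 + 0, x + y) by []; rewrite addr0.
rewrite (big_morph hull_inj D erefl); apply: eq_bigr => j _.
by rewrite hullM /hull_mul /= mulr0 scale0r amul0l !addr0.
Qed.

Lemma hull_inj_ideal : ideal2 (range hull_inj).
Proof.
split; first split; first by exists 0.
- by move=> _ _ [a _ <-] [b _ <-]; exists (a - b); rewrite ?hull_injB.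
- move=> [k u] _ [a _ <-]; exists (k *: a + amul u a) => //.
  by rewrite [RHS]/(hull_mul _ _) /hull_mul /= mulr0 scale0r addr0.
- move=> [k u] _ [a _ <-]; exists (k *: a + amul a u) => //.
  by rewrite [RHS]/(hull_mul _ _) /hull_mul /= mul0r scale0r add0r.
Qed.

Lemma hull_pchar p : p \in [pchar K] -> p \in [pchar (unital_hull A)].
Proof.
move=> /andP[pp /eqP p0]; apply/andP; split=> //; apply/eqP.
have h n : (n%:R : unital_hull A) = (n%:R, 0).
  elim: n => [//|n IH]; rewrite -addn1 natrD IH.
  have -> : ((n%:R, 0) : unital_hull A) + 1 = (n%:R + 1, 0 + 0) by [].
  by rewrite addr0 natrD.
by rewrite h p0.
Qed.

End UnitalHull.

Section Automorphisms.
Variables (p : nat) (A : assocAlgType 'F_p).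

Definition hull_aut (f : A -> A) (u : unital_hull A) : unital_hull A := (u.1, f u.2).

Definition hull_auts : set (unital_hull A -> unital_hull A) :=
  [set hull_aut f | f in @is_aut _ A].

Lemma aut_inv (f : A -> A) : is_aut f -> exists h, [/\ is_aut h, cancel f h & cancel h f].
Proof.
move=> [[h fh hf] fD fM]; exists h; split=> //; split; first by exists f.
  by move=> x y; apply: (can_inj fh); rewrite fD !hf.
by move=> x y; apply: (can_inj fh); rewrite fM !hf.
Qed.

Lemma aut0 (f : A -> A) : is_aut f -> f 0 = 0.
Proof. by move=> [_ fD _]; apply: (addrI (f 0)); rewrite -fD !addr0. Qed.

Lemma autB (f : A -> A) : is_aut f -> {morph f : x y / x - y}.
Proof.
move=> af x y; have [_ fD _] := af; apply: (addIr (f y)).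
by rewrite -fD !subrK.
Qed.

Lemma autZ (f : A -> A) : is_aut f -> forall k x, f (k *: x) = k *: f x.
Proof.
move=> af k x; have [_ fD _] := af.
rewrite -(natr_Zp k) !scaler_nat; elim: (k : nat) => [|n IH].
  by rewrite !mulr0n (aut0 af).
by rewrite !mulrS fD IH.
Qed.

Lemma hull_auts_autgroup : autgroup hull_auts.
Proof.
move=> _ [f af <-]; have [h [ah fh hf]] := aut_inv af; split.
- by move=> [a x] [b y]; rewrite /hull_aut /= (autB af).
- move=> [a x] [b y]; have [_ fD fM] := af.
  rewrite !hullM /hull_aut /hull_mul /=.
  by rewrite !fD fM !(autZ af).
- exists (hull_aut h); split; first by exists h.
    by move=> [a x]; rewrite /hull_aut /= fh.
  by move=> [a x]; rewrite /hull_aut /= hf.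
Qed.

Lemma hull_auts_inv : invariant hull_auts (range (@hull_inj _ A)).
Proof. by move=> _ _ [f af <-] [x _ <-]; exists (f x). Qed.

Lemma finite_set_bound (T : choiceType) (D : set T) (P : nat -> T -> Prop) :
  finite_set D -> (forall n t, P n t -> P n.+1 t) ->
  (forall t, D t -> exists n, P n t) -> exists n, forall t, D t -> P n t.
Proof.
move=> /finite_seqP[s ->] Pm H.
have Ple m n t : (m <= n)%N -> P m t -> P n t.
  by move=> /subnKC <-; elim: (n - m)%N => [|d IH]; rewrite ?addn0 // addnS => /IH/Pm.
elim: s H => [|t s IH] H; first by exists 0%N.
have [m hm] : exists n, P n t by apply: H; rewrite /= mem_head.
have [n hn] := IH (fun t' ts => H t' (mem_behead (s := t :: s) ts)).
exists (maxn m n) => t' /=; rewrite inE => /predU1P[->|ts].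
  exact: Ple (leq_maxl m n) hm.
exact: Ple (leq_maxr m n) (hn _ ts).
Qed.

Lemma omega_categorical_oligomorphic : omega_categorical A ->
  oligomorphic hull_auts (range (@hull_inj _ A)).
Proof.
move=> /(_ 3%N) fin X mX iX cX.
pose Y n (t : 3.-tuple A) :=
  X n (hull_inj (nth 0 t 0)) (hull_inj (nth 0 t 1)) (hull_inj (nth 0 t 2)).
have id_aut : is_aut (fun x : A => x) by split=> //; exists id.
have Yorb n t t' : aut_orbit t = aut_orbit t' -> Y n t -> Y n t'.
  move=> e; have : aut_orbit t t'.
    rewrite e; exists id => //; apply: val_inj; exact: map_id.
  move=> [f af <-]; rewrite /Y /=.
  rewrite !(nth_map 0) ?size_tuple //.
  by move=> h; apply: (iX (hull_aut f)) h; exists f.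
have [n hn] : exists n, forall o, range (@aut_orbit _ A 3) o ->
    forall t, aut_orbit t = o -> Y n t.
  apply: (finite_set_bound (P := fun n o => forall t, aut_orbit t = o -> Y n t)) fin _ _.
    by move=> n o h t /h; exact: mX.
  move=> _ [t _ <-].
  have [n hn] := cX _ _ _ (imageT (@hull_inj _ A) (nth 0 t 0))
    (imageT (@hull_inj _ A) (nth 0 t 1)) (imageT (@hull_inj _ A) (nth 0 t 2)).
  by exists n => t' e; apply: (Yorb n t) => //; rewrite e.
exists n => _ _ _ [a _ <-] [b _ <-] [c _ <-].
by have := hn _ (imageT _ [tuple a; b; c]) _ erefl.
Qed.

End Automorphisms.

Lemma ideal_powSl (U : nzRingType) (N : set U) j x y :
  N x -> ideal_pow N j y -> ideal_pow N j.+1 (x * y).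
Proof.
move=> Nx; elim: j y => [|j IH] y hy; first by apply: addspan_sub; exists x, y.
apply: (addspan_map (g := fun z => x * z) _ _ hy) => [a b|_ [a [b [ha hb ->]]]].
  by rewrite mulrBr.
by apply: addspan_sub; exists (x * a), b; rewrite mulrA; split=> //; exact: IH.
Qed.

Theorem theorem2p8 (p : nat) (hp : prime p) (n : nat) (hn : (1 <= n)%N)
    (A : assocAlgType 'F_p) (hA : omega_categorical A)
    (hE : n_engel (lie_of A) n) :
  lie_nilpotent (lie_of A).
Proof.
pose M := range (@hull_inj _ A); pose G := @hull_auts p A.
have charU : p \in [pchar (unital_hull A)] by apply: hull_pchar; exact: pchar_Fp.
have aG : autgroup G := @hull_auts_autgroup p A.
have oM : oligomorphic G M := omega_categorical_oligomorphic hA.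
have idM : ideal2 M := @hull_inj_ideal _ A.
have injL (x y : A) : hull_inj (@lie _ (lie_of A) x y) = rad (hull_inj y) (hull_inj x).
  by rewrite /rad -!hull_injM -hull_injB.
have engel x y : M x -> M y -> iter n (rad y) x = 0.
  move=> [a _ <-] [b _ <-].
  have -> : iter n (rad (hull_inj b)) (hull_inj a)
      = hull_inj (iter n (fun z => @lie _ (lie_of A) z b) a).
    by elim: n {hn hE} => //= m ->; rewrite injL.
  by rewrite hE.
have [N [idN iN NM [Q nilN] hN]] :=
  engel_reduction charU aG idM (@hull_auts_inv p A) oM engel.
have [c hc] := nil_nilpotent aG idN iN (oligomorphic_sub aG oM NM iN) nilN.
have radE z x y : M x -> (forall y', M y' -> z * y' = y' * z) -> N (y - z) ->
    rad y x = rad (y - z) x.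
  by move=> Mx cz _; rewrite /rad mulrBr mulrBl cz // opprB addrA subrK.
have key i (a : A) : @lower_central _ (lie_of A) i.+1 a -> ideal_pow N i.+1 (hull_inj a).
  elim: i a => [|i IH] a [m [k [w [hw ->]]]]; rewrite (@hull_inj_sum _ A).
    have [sP Pl _] := ideal_pow_ideal idN 1.
    apply: subgrp_sum => // j _; apply: Pl.
    have [x _ [y _ <-]] := hw j; rewrite injL.
    have Mx : M (hull_inj x) by exists x.
    have My : M (hull_inj y) by exists y.
    have [zx [Nx cx]] := hN _ Mx; have [zy [Ny cy]] := hN _ My.
    rewrite (radE _ _ _ Mx cy Ny).
    move: (hull_inj y - zy) Ny => v Nv.
    have -> : rad v (hull_inj x) = (hull_inj x - zx) * v - v * (hull_inj x - zx).
      by rewrite mulrBl mulrBr (cx _ (NM _ Nv)) opprB addrA subrK.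
    apply: sP.2; apply: addspan_sub; first by exists (hull_inj x - zx), v.
    by exists v, (hull_inj x - zx).
  have [sP Pl _] := ideal_pow_ideal idN i.+2.
  apply: subgrp_sum => // j _; apply: Pl.
  have [x /IH hx [y _ <-]] := hw j; rewrite injL.
  have Mx : M (hull_inj x) by exists x.
  have My : M (hull_inj y) by exists y.
  have [zy [Ny cy]] := hN _ My.
  rewrite (radE _ _ _ Mx cy Ny); apply: sP.2; last exact: ideal_powSl.
  by apply: addspan_sub; exists (hull_inj x), (hull_inj y - zy).
exists c.+1; apply/seteqP; split=> [a /key h|_ ->].
  have /hc[//] : ideal_pow N c (hull_inj a) by exact: (ideal_powS idN).
by exists 0%N, (fun=> 0), (fun=> 0); split; [case | rewrite big_ord0].
Qed.
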